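(* Suppose $\delta\in(0,1)$ is a real number and $h\ge 3$ is an integer. If $k=[h/3]$ then $$T(h,\delta)\leq X\left(\frac{1}{k!}\left(\log\frac{3-(k-1)\delta}{(h-k+1)\delta}\right)^k+o(1)\right).$$
   Context: $[\cdot]$ denotes the integer part. For a real parameter $X$ and $\delta>0$, and an integer $n\in(X,2X]$, $\Omega_\delta(n^3+2)$ denotes the number of primes $p\mid n^3+2$ with $p\ge X^\delta$, counted with multiplicity. For an integer $h$, $$T(h,\delta)=\#\{n\in\mathbb{Z}: X<n\le 2X,\ \Omega_\delta(n^3+2)\ge h\},$$ which depends on $X$. The term $o(1)$ denotes a quantity tending to $0$ as $X\to\infty$ for fixed $h,\delta$.
   Formalization: The formal theorem adds the assumption hδ ≤ 3 when k is odd: for odd k and hδ > 3 the logarithm is negative or undefined, so the printed bound is false or meaningless (e.g. h=4, δ=0.9, k=1 gives log(3/3.6) < 0 while T ≥ 0). *)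

(* Defs.v *)
From HB Require Import structures.
From mathcomp Require Import all_boot all_order all_algebra.
From mathcomp Require Import finmap.
From mathcomp Require Import all_classical all_reals all_analysis.
Set Implicit Arguments. Unset Strict Implicit. Unset Printing Implicit Defensive.
Import Order.TTheory GRing.Theory Num.Theory.
Import numFieldNormedType.Exports.
Local Open Scope classical_set_scope.
Local Open Scope ring_scope.

Definition Omega_ge (R : realType) (X delta : R) (m : nat) : nat :=
  (\sum_(p <- primes m | (X `^ delta <= p%:R)%R) logn p m)%N.

Definition Tset (R : realType) (X delta : R) (h : nat) : set int :=
  [set n : int | X < n%:~R <= 2 * X /\
                 (h <= Omega_ge X delta `|(n ^+ 3 + 2)%R|)%N].

(* [fset_set] returns the empty set on infinite sets; see [finite_Tset]. *)
Definition Tcount (R : realType) (X delta : R) (h : nat) : nat :=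
  #|` fset_set (Tset X delta h)|%fset.

Lemma finite_Tset (R : realType) (X delta : R) (h : nat) :
  finite_set (Tset X delta h).
Proof.
have [X0|X0] := leP X 0.
  rewrite (_ : Tset _ _ _ = set0); first exact: finite_set0.
  rewrite -subset0 => n [/andP[a b] _] /=.
  have := lt_le_trans a b.
  by rewrite mulr_natl mulr2n -[ltLHS]addr0 ltrD2l ltNge X0.
apply: (@sub_finite_set _ _ (Posz @` `I_(Num.truncn (2 * X)).+1)); last first.
  exact: finite_image.
move=> n [/andP[a b] _].
have n0 : (0 : R) < n%:~R by exact: lt_trans a.
case: n n0 a b => [n|n] n0 a b; last by rewrite ltr0z in n0.
exists n => //=.
by rewrite ltnS truncn_ge_nat // mulr_ge0 // ltW.
Qed.

(* Main.v *)
(* If n^3 + 2 has at least h prime factors p >= X^delta, its k smallest ones have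
   a product of size at most about X and are themselves at most about X^beta, where
   beta = (3 - (k - 1) delta) / (h - k + 1).  For most n they are distinct; counting
   the n in each residue class modulo their product bounds T(h, delta) by X / k!
   times the k-th power of the sum of rho(p) / p over X^delta <= p <= X^beta, where
   rho(p) is the number of roots of t^3 + 2 mod p.  The error terms are O(X / log X)
   by Chebyshev's bound.

   That sum is asymptotically log (beta / delta) by Mertens' theorem for the primes
   of degree one of Q(2^(1/3)), proved here as in Chebyshev's argument but with a
   box of elements of Z[(-2)^(1/3)] instead of an interval of integers: the sum of
   log |norm| over the box is computed both directly and prime by prime.  For a root
   t of t^3 + 2 mod p, the elements a + b c + d c^2, c^3 = -2, with
   a + b t + d t^2 = 0 mod p form a lattice of index p.  Its nonzero elements have
   norm at least p in absolute value, hence length at least of order p^(1/3), so the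
   lattice is balanced and equidistributes in boxes of volume up to the order of p;
   no unit or class group theory is needed. *)

(* The cube of the product of the k smallest primes is at most n^3 + 2 because h >= 3 k, whence k =
   [h / 3]. A modulus d = O(X) is needed since a class modulo d contains X / d + O(1) of the n: the
   O(1) are harmless only because there are just O(X / log X) tuples of primes >= X^delta with
   product O(X). The value of beta expresses that k - 1 of the primes are at least X^delta and that
   h - k + 1 are at least the k-th one.

   In the Mertens part, the primes run up to the size B of the norms, which is of the order of the
   volume of the box. The equidistribution error L^2 / p^(2/3), weighted by ln p and summed up to B,
   is O(L^2 B^(1/3)) = O(L^3), hence bounded per element. The number of roots attached to an element
   agrees with the valuation of its norm unless p^2 divides the norm; the exceptions with p > z have
   density O(1 / z) and cost O(ln B) each. So the sum of rho(p) ln p / p is known only up to e ln x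
   + O(1), for every e > 0. This suffices: delta and beta are fixed, and the interval between them
   is cut into finitely many pieces before e is chosen. *)
Require Import Defs.
From HB Require Import structures.
From mathcomp Require Import all_boot all_order all_algebra.
From mathcomp Require Import ring lra zify.
From mathcomp Require Import finmap.
From mathcomp Require Import all_classical all_reals all_analysis.
Set Implicit Arguments. Unset Strict Implicit. Unset Printing Implicit Defensive.
Import Order.TTheory GRing.Theory Num.Theory.
Import numFieldNormedType.Exports.
Local Open Scope ring_scope.

(** * The norm form of [Z[(-2)^(1/3)]] *)

(* The norm of [a + b x + c x^2] for [x^3 = -2]. *)
Definition nrm (a b c : int) : int :=
  a ^+ 3 - 2 * b ^+ 3 + 4 * c ^+ 3 + 6 * a * b * c.

Definition ev (t a b c : int) : int := a + b * t + c * t ^+ 2.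

(** With u = b t and v = c t^2, the factorisation of a^3 + u^3 + v^3 - 3 a u v by a + u + v becomes
    one of the norm once t^3 is replaced by -2. *)
Lemma dvdz_nrm (m t a b c : int) :
  (m %| t ^+ 3 + 2)%Z -> (m %| ev t a b c)%Z -> (m %| nrm a b c)%Z.
Proof.
move=> ht he.
rewrite (_ : nrm a b c = ev t a b c *
    (a ^+ 2 + b ^+ 2 * t ^+ 2 + c ^+ 2 * t ^+ 4 - a * b * t - b * c * t ^+ 3
     - a * c * t ^+ 2)
  + (t ^+ 3 + 2) * (3 * a * b * c - b ^+ 3 - c ^+ 3 * (t ^+ 3 - 2))).
  by rewrite rpredD // dvdz_mulr.
by rewrite /nrm /ev; ring.
Qed.

Lemma even_cube (a x : int) : a ^+ 3 = 2 * x -> exists y, a = 2 * y.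
Proof.
move=> h; exists (a %/ 2)%Z.
have := divz_eq a 2; have : (a %% 2)%Z = 0 \/ (a %% 2)%Z = 1 by lia.
case=> -> e; first lia.
exfalso; have : (a %/ 2)%Z * 2 + 1 = a by lia.
set q := (a %/ 2)%Z => E; rewrite -E in h.
have : 2 * (4 * q ^+ 3 + 6 * q ^+ 2 + 3 * q - x) = -1 by move: h; lia.
lia.
Qed.

(** Infinite descent at 2, where x^3 + 2 is Eisenstein: in a zero of the norm a, then b, then c must
    be even, and halving them gives a smaller zero. *)
Lemma nrm_eq0 (a b c : int) : nrm a b c = 0 -> [/\ a = 0, b = 0 & c = 0].
Proof.
have [n] := ubnP (`|a| + `|b| + `|c|)%N; elim: n a b c => // n IH a b c hn h.
have [a' ea] : exists y, a = 2 * y.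
  apply: (@even_cube _ (b ^+ 3 - 2 * c ^+ 3 - 3 * a * b * c)).
  by move: h; rewrite /nrm; lia.
have [b' eb] : exists y, b = 2 * y.
  apply: (@even_cube _ (2 * a' ^+ 3 + c ^+ 3 + 3 * a' * b * c)).
  by move: h; rewrite /nrm ea; lia.
have [c' ec] : exists y, c = 2 * y.
  apply: (@even_cube _ (- a' ^+ 3 + 2 * b' ^+ 3 - 3 * a' * b' * c)).
  by move: h; rewrite /nrm ea eb; lia.
have h' : nrm a' b' c' = 0.
  apply: (mulfI (_ : 8 != 0 :> int)) => //; rewrite mulr0 -h ea eb ec /nrm.
  by ring.
have [z|nz] := boolP [&& a' == 0, b' == 0 & c' == 0].
  by case/and3P: z ea eb ec => /eqP-> /eqP-> /eqP->.
have /IH/(_ h') [ea' eb' ec'] : (`|a'| + `|b'| + `|c'| < n)%N.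
  by clear - ea eb ec hn nz; lia.
by rewrite ea eb ec ea' eb' ec'.
Qed.

(** 13 = 1 + 2 + 4 + 6 is the sum of the absolute values of the coefficients of the norm form. *)
Lemma nrm_bound (a b c m : int) :
  `|a| <= m -> `|b| <= m -> `|c| <= m -> `|nrm a b c| <= 13 * m ^+ 3.
Proof.
move=> ha hb hc.
have hm x y z : `|x| <= m -> `|y| <= m -> `|z| <= m -> `|x * y * z| <= m ^+ 3.
  move=> hx hy hz; rewrite !normrM !exprS expr0 mulr1 mulrA.
  by apply: ler_pM => //; apply: ler_pM.
have := hm _ _ _ ha ha ha; have := hm _ _ _ hb hb hb.
have := hm _ _ _ hc hc hc; have := hm _ _ _ ha hb hc.
rewrite (_ : nrm a b c = a*a*a - 2*(b*b*b) + 4 * (c*c*c) + 6 * (a*b*c)).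
  by set u := a*a*a; set v := b*b*b; set w := c*c*c; set s := a*b*c; lia.
by rewrite /nrm; ring.
Qed.

(** * Primes dividing a norm and roots of t^3 + 2 *)

Section PrimePower.
Variable p : nat.
Hypothesis p_prime : prime p.

Lemma Euclidz (x y : int) : (p%:Z %| x * y)%Z -> (p%:Z %| x)%Z || (p%:Z %| y)%Z.
Proof. by rewrite !dvdzE abszM /= Euclid_dvdM. Qed.

Lemma Euclidz_exp (x : int) n : (p%:Z %| x ^+ n)%Z -> (p%:Z %| x)%Z.
Proof. by rewrite !dvdzE abszX /= Euclid_dvdX // => /andP[]. Qed.

Lemma invz_mod (e : int) j : ~~ (p%:Z %| e)%Z ->
  exists u, ((p ^ j)%N%:Z %| u * e - 1)%Z.
Proof.
move=> he; have co : coprimez e (p ^ j)%N.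
  rewrite coprimezE absz_nat coprimeXr // coprime_sym prime_coprime //.
have [[u v] /= h] := coprimezP _ _ co; exists u.
rewrite -h (_ : _ - _ = - v * (p ^ j)%N); first by rewrite dvdz_mull.
by ring.
Qed.

(* Eliminating [t^3] and [t^2] between [t^3 = -2] and [a + b t + c t^2 = 0] leaves
   [(a c - b^2) t = a b + 2 c^2]. *)
Lemma nrm_root (a b c : int) j : ~~ (p%:Z %| a * c - b ^+ 2)%Z ->
  ((p ^ j)%N%:Z %| nrm a b c)%Z ->
  exists t, ((p ^ j)%N%:Z %| t ^+ 3 + 2)%Z /\ ((p ^ j)%N%:Z %| ev t a b c)%Z.
Proof.
move=> he hN; have [u hu] := invz_mod j he.
set e := a * c - b ^+ 2 in hu he; pose f := a * b + 2 * c ^+ 2.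
exists (u * f); split.
  rewrite (_ : _ + 2 = nrm a b c * (u ^+ 3 * (b ^+ 3 + 2 * c ^+ 3))
     + (u * e - 1) * (-2 * (u ^+ 2 * e ^+ 2 + u * e + 1))).
    by rewrite rpredD // dvdz_mulr.
  by rewrite /nrm /e /f; ring.
rewrite (_ : ev _ _ _ _ = nrm a b c * (u ^+ 2 * c ^+ 2)
   + (u * e - 1) * (- a * (u * e + 1) - b * u * f)).
  by rewrite rpredD // dvdz_mulr.
by rewrite /nrm /ev /e /f; ring.
Qed.

Lemma nrm_root_uniq (a b c t t' : int) : ~~ (p%:Z %| a * c - b ^+ 2)%Z ->
  (p%:Z %| t ^+ 3 + 2)%Z -> (p%:Z %| ev t a b c)%Z ->
  (p%:Z %| t' ^+ 3 + 2)%Z -> (p%:Z %| ev t' a b c)%Z ->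
  (p%:Z %| t - t')%Z.
Proof.
move=> he ht hE ht' hE'.
have key s : (p%:Z %| s ^+ 3 + 2)%Z -> (p%:Z %| ev s a b c)%Z ->
    (p%:Z %| (a * c - b ^+ 2) * s - (a * b + 2 * c ^+ 2))%Z.
  move=> h1 h2; rewrite (_ : _ - _ = ev s a b c * (c * s - b)
      + (s ^+ 3 + 2) * (- c ^+ 2)).
    by rewrite rpredD // dvdz_mulr.
  by rewrite /ev; ring.
have := rpredB (key _ ht hE) (key _ ht' hE').
rewrite (_ : _ - _ = (a * c - b ^+ 2) * (t - t')); last by ring.
by move/Euclidz; rewrite (negPf he).
Qed.

(** The case that [nrm_root] leaves out. If c is invertible and t = b / c, then (a, b, c) is c (t^2,
    t, 1) modulo p, whose norm is c^3 (t^3 + 2)^2; so t is a root. *)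
Lemma nrm_degenerate (a b c : int) : (p%:Z %| a * c - b ^+ 2)%Z ->
  (p%:Z %| nrm a b c)%Z ->
  [/\ (p%:Z %| a)%Z, (p%:Z %| b)%Z & (p%:Z %| c)%Z] \/
  exists t, [/\ (p%:Z %| t ^+ 3 + 2)%Z, (p%:Z %| b - c * t)%Z
              & (p%:Z %| a - c * t ^+ 2)%Z].
Proof.
move=> he hN; have [hc|hc] := boolP (p%:Z %| c)%Z.
  left; have hb : (p%:Z %| b)%Z.
    apply: (@Euclidz_exp _ 2).
    have : (p%:Z %| a * c - (a * c - b ^+ 2))%Z by rewrite rpredB // dvdz_mull.
    by rewrite (_ : _ - _ = b ^+ 2); last ring.
  split=> //; apply: (@Euclidz_exp _ 3).
  have : (p%:Z %| nrm a b c + b * (2 * b ^+ 2) - c * (4 * c ^+ 2 + 6 * a * b))%Z.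
    by apply: rpredB; [apply: rpredD => //|]; rewrite dvdz_mulr.
  by rewrite (_ : _ - _ = a ^+ 3) // /nrm; ring.
right; have [u] := invz_mod 1 hc; rewrite expn1 => hu.
have hb : (p%:Z %| b - c * (u * b))%Z.
  rewrite (_ : _ - _ = (u * c - 1) * - b); first by rewrite dvdz_mulr.
  by ring.
have ha : (p%:Z %| a - c * (u * b) ^+ 2)%Z.
  rewrite (_ : _ - _ = (a * c - b ^+ 2) * (u ^+ 2 * c)
     + (u * c - 1) * (- a * (u * c + 1))).
    by rewrite rpredD // dvdz_mulr.
  by ring.
exists (u * b); split=> //.
set t := u * b in ha hb *.
have : (p%:Z %| c ^+ 3 * (t ^+ 3 + 2) ^+ 2)%Z.
  rewrite (_ : _ * _ = nrm a b c - nrm a b c + c ^+ 3 * (t ^+ 3 + 2) ^+ 2);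
    last by ring.
  rewrite (_ : _ + _ = nrm a b c
    - (a - c * t ^+ 2) * (a ^+ 2 + a * (c * t ^+ 2) + (c * t ^+ 2) ^+ 2 + 6 * b * c)
    + (b - c * t) * (2 * (b ^+ 2 + b * (c * t) + (c * t) ^+ 2) - 6 * c ^+ 2 * t ^+ 2)).
    by apply: rpredD; [apply: rpredB => //|]; rewrite dvdz_mulr.
  by rewrite /nrm; ring.
move=> /Euclidz /orP[/Euclidz_exp|/Euclidz_exp] //.
by rewrite (negPf hc).
Qed.

(** At (t^2, t, 1) the norm is (t^3 + 2)^2 and its gradient is a multiple of t^3 + 2. Hence changing
    the coordinates by multiples of p changes the norm by a multiple of p^2. *)
Lemma dvdz_sqr_nrm (a b c t : int) :
  (p%:Z %| t ^+ 3 + 2)%Z -> (p%:Z %| b - c * t)%Z ->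
  (p%:Z %| a - c * t ^+ 2)%Z -> ((p ^ 2)%N%:Z %| nrm a b c)%Z.
Proof.
move=> /dvdzP[x ht] /dvdzP[y hb] /dvdzP[z ha].
have ea : a = c * t ^+ 2 + z * p by rewrite -ha; ring.
have eb : b = c * t + y * p by rewrite -hb; ring.
apply/dvdzP; exists (c ^+ 3 * x ^+ 2 + 3 * c ^+ 2 * t * z * x + 3 * c * t ^+ 2 * z ^+ 2
  + z ^+ 3 * p - 2 * (3 * c * t * y ^+ 2 + y ^+ 3 * p) + 6 * c * y * z).
have -> : ((p ^ 2)%N%:Z = p%:Z ^+ 2)%R by lia.
apply/eqP; rewrite -subr_eq0 ea eb /nrm; apply/eqP.
rewrite (_ : _ - _ = (t ^+ 3 + 2 - x * p) * (c ^+ 3 * (t ^+ 3 + 2 + x * p)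
   + 3 * c ^+ 2 * t * z * p)); first by rewrite ht subrr mul0r.
ring.
Qed.

End PrimePower.

(** * Equidistribution of the prime lattices *)

Lemma evB (t a b c a' b' c' : int) :
  ev t (a - a') (b - b') (c - c') = ev t a b c - ev t a' b' c'.
Proof. by rewrite /ev; ring. Qed.

Lemma evD (t a b c a' b' c' : int) :
  ev t (a + a') (b + b') (c + c') = ev t a b c + ev t a' b' c'.
Proof. by rewrite /ev; ring. Qed.

Lemma nrm_small_eq0 (q m : nat) (a b c : int) :
  (13 * m ^ 3 < q)%N -> `|a| <= m%:Z -> `|b| <= m%:Z -> `|c| <= m%:Z ->
  (q%:Z %| nrm a b c)%Z -> [/\ a = 0, b = 0 & c = 0].
Proof.
move=> hm ha hb hc hd; apply: nrm_eq0; apply/eqP.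
move: (nrm_bound ha hb hc) hd; move: (nrm a b c) => N hN.
rewrite dvdzE -absz_eq0 /= => hd; apply/negPn/negP => N0.
have := dvdn_leq _ hd; rewrite lt0n N0 => /(_ isT).
have : (`|N| <= 13 * m ^ 3)%N by lia.
by lia.
Qed.

Definition resord (q : nat) (x : int) : 'I_q.+1 := inord `|(x %% q.+1)%Z|.

Lemma resord_eq (q : nat) (x y : int) :
  resord q x = resord q y -> (q.+1%:Z %| x - y)%Z.
Proof.
move=> /(congr1 val); rewrite /= !inordK; try lia.
by move=> h; rewrite -eqz_mod_dvd; apply/eqP; lia.
Qed.

Definition clip (i a : int) : int := Num.max (- i) (Num.min i a).

(** The points [clip i] of the coordinates form a path from 0 to the representative, and i and i'
    are two box corners on it. A coordinate with |y| >= i' moves towards 0 by at least m + 1, and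
    any other one ends within i + m of 0; both leave at most n - 1. *)
Lemma clip_exchange (n i i' m s s' y : int) :
  0 <= i -> i + 2 * m + 1 <= i' -> i' <= n -> 0 <= s <= m -> 0 <= s' <= m ->
  `|y| <= n -> `|y + (clip i y + s - (clip i' y + s'))| <= n - 1.
Proof. by rewrite /clip; lia. Qed.

(* Every residue class mod [q] has a small representative: translating the box
   [[0, m]^3], which is injective mod [q] and has at least [q / 13] elements,
   along the segment from [0] to a representative of norm [n > 13 (2 m + 1)]
   gives 14 boxes, two of which must meet, and the collision shortens the
   representative. *)
Lemma ev_covering (q m : nat) (t r : int) : (0 < q)%N ->
  (q%:Z %| t ^+ 3 + 2)%Z -> (13 * m ^ 3 < q)%N -> (q <= 13 * m.+1 ^ 3)%N ->
  exists a b c : int, [/\ `|a| <= 13 * (2 * m%:Z + 1), `|b| <= 13 * (2 * m%:Z + 1),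
     `|c| <= 13 * (2 * m%:Z + 1) & (q%:Z %| ev t a b c - r)%Z].
Proof.
case: q => // q _ ht hm hq.
set D := 13 * (2 * m%:Z + 1).
suff H n (a b c : int) : `|a| <= n%:Z -> `|b| <= n%:Z -> `|c| <= n%:Z ->
    (q.+1%:Z %| ev t a b c - r)%Z ->
    exists a b c : int, [/\ `|a| <= D, `|b| <= D, `|c| <= D
      & (q.+1%:Z %| ev t a b c - r)%Z].
  apply: (H `|r|%N r 0 0); try lia.
  by rewrite /ev (_ : _ - _ = 0) //; ring.
elim/ltn_ind: n a b c => n IH a b c ha hb hc hr.
have [hn|hn] := leP n%:Z D.
  by exists a, b, c; split=> //; lia.
pose x (j : int) (a : int) := clip (j * (2 * m%:Z + 1)) a.
pose f (u : 'I_14 * ('I_m.+1 * ('I_m.+1 * 'I_m.+1))) : 'I_q.+1 :=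
  let: (j, (s1, (s2, s3))) := u in
  resord q (ev t (x j%:Z a + s1%:Z) (x j%:Z b + s2%:Z) (x j%:Z c + s3%:Z)).
(* The 14 boxes have 14 (m + 1)^3 points in all, more than the 13 (m + 1)^3 that bound the
   modulus. *)
have /injectivePn[u [v nuv]] : ~~ injectiveb f.
  apply/negP => /injectiveP /leq_card.
  by rewrite !card_prod !card_ord; lia.
case: u v nuv => [j [s1 [s2 s3]]] [j' [s1' [s2' s3']]] nuv /resord_eq.
wlog lejj : j j' s1 s2 s3 s1' s2' s3' nuv / (j <= j')%N.
  move=> G h; have [l|l] := leqP j j'; first exact: (G j j' s1 s2 s3 s1' s2' s3').
  apply: (G j' j s1' s2' s3' s1 s2 s3); [by rewrite eq_sym| exact: ltnW|].
  by rewrite -opprB rpredN.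
rewrite -evB => hd.
have [[s1b s2b] s3b] := (ltn_ord s1, ltn_ord s2, ltn_ord s3).
have [[s1b' s2b'] s3b'] := (ltn_ord s1', ltn_ord s2', ltn_ord s3').
have jb' := ltn_ord j'.
(* A collision inside one box would give a nonzero lattice element with coordinates at most m, too
   short by [nrm_small_eq0]. *)
have [ejj|njj] := eqVneq j j'.
  exfalso; move: hd; rewrite ejj => hd.
  have [] := nrm_small_eq0 hm _ _ _ (dvdz_nrm ht hd); try (clear -s1b s2b s3b s1b' s2b' s3b'; lia).
  move=> h1 h2 h3; move: nuv; rewrite ejj => /eqP; apply.
  by congr (_, (_, (_, _))); apply/val_inj => /=; clear - h1 h2 h3; lia.
have ltjj : (j < j')%N by rewrite ltn_neqAle njj.
have new (s s' : nat) (y : int) : (s <= m)%N -> (s' <= m)%N -> `|y| <= n%:Z ->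
    `|y + (x j%:Z y + s%:Z - (x j'%:Z y + s'%:Z))| <= (n.-1)%:Z.
  move=> hs hs' hy; have -> : (n.-1)%:Z = n%:Z - 1 by clear -hn; lia.
  have w0 : 0 <= 2 * m%:Z + 1 by [].
  apply: (@clip_exchange n _ _ m) => //; rewrite ?mulr_ge0 //.
  - have : j%:Z + 1 <= j'%:Z by clear -ltjj; lia.
    by move/(ler_wpM2r w0); rewrite mulrDl mul1r addrA.
  - apply: (le_trans _ (ltW hn)); exact: ler_wpM2r.
apply: (IH n.-1 _ _ _ _ (new s1 s1' a _ _ ha) (new s2 s2' b _ _ hb)
  (new s3 s3' c _ _ hc)) => //; first lia.
by rewrite evD addrAC rpredD.
Qed.

(** Translating by (D, D, D) makes the coordinates of the representatives natural numbers, at most 2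
    D = 26 (2 m + 1). *)
Lemma ev_covering_nat (q m : nat) (t r : int) : (0 < q)%N ->
  (q%:Z %| t ^+ 3 + 2)%Z -> (13 * m ^ 3 < q)%N -> (q <= 13 * m.+1 ^ 3)%N ->
  exists x : 'I_(26 * (2 * m + 1)).+1 * 'I_(26 * (2 * m + 1)).+1 *
             'I_(26 * (2 * m + 1)).+1,
    (q%:Z %| ev t x.1.1%:Z x.1.2%:Z x.2%:Z - r)%Z.
Proof.
move=> q0 ht hm hq; pose D : int := 13 * (2 * m%:Z + 1).
have [a [b [c [ha hb hc h]]]] := ev_covering (r - ev t D D D) q0 ht hm hq.
pose o (y : int) : 'I_(26 * (2 * m + 1)).+1 := inord `|y + D|.
have oE y : `|y| <= D -> (o y)%:Z = y + D.
  by move=> hy; rewrite /= inordK; move: hy; rewrite /D; lia.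
exists (o a, o b, o c); rewrite /fst /snd !oE // evD.
by rewrite (_ : _ - _ = ev t a b c - (r - ev t D D D)) //; ring.
Qed.

(** Inverting W modulo q; this reduces counting among the elements congruent to 1 modulo W to
    [ev_sol]. *)
Lemma dvdz_affine (q W : nat) (u : int) : coprime W q ->
  exists r : int, forall y : int, (q%:Z %| u + W%:Z * y)%Z = (q%:Z %| y - r)%Z.
Proof.
move=> co; have /coprimezP[[v w] /= h] : coprimez W q by rewrite coprimezE.
exists (- u * v) => y; apply/idP/idP => hd.
  rewrite (_ : _ - _ = v * (u + W%:Z * y) + y * w * q%:Z).
    by rewrite rpredD // dvdz_mull.
  by rewrite -[y in LHS]mulr1 -h; ring.
rewrite (_ : _ + _ = W%:Z * (y - - u * v) + u * w * q%:Z).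
  by rewrite rpredD // dvdz_mull.
by rewrite -[u in LHS]mulr1 -h; ring.
Qed.

Section EvCount.
Variables (q m L : nat) (t r : int).
Hypotheses (q0 : (0 < q)%N) (ht : (q%:Z %| t ^+ 3 + 2)%Z).
Hypotheses (hm : (13 * m ^ 3 < q)%N) (hq : (q <= 13 * m.+1 ^ 3)%N).
Local Notation E := (26 * (2 * m + 1))%N.

Definition ev_sol : {set 'I_L * 'I_L * 'I_L} :=
  [set x : 'I_L * 'I_L * 'I_L | (q%:Z %| ev t x.1.1%:Z x.1.2%:Z x.2%:Z - r)%Z].

Lemma ev_reps : exists F : 'I_q -> 'I_E.+1 * 'I_E.+1 * 'I_E.+1,
  forall s : 'I_q, (q%:Z %| ev t (F s).1.1%:Z (F s).1.2%:Z (F s).2%:Z - s%:Z)%Z.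
Proof.
apply: (@fin_all_exists _ _ (fun (s : 'I_q) (x : 'I_E.+1 * 'I_E.+1 * 'I_E.+1) =>
  (q%:Z %| ev t x.1.1%:Z x.1.2%:Z x.2%:Z - s%:Z)%Z)) => s.
exact: ev_covering_nat.
Qed.

Lemma ord_dvdz_eq (s s' : 'I_q) : (q%:Z %| s%:Z - s'%:Z)%Z -> s = s'.
Proof.
rewrite -eqz_mod_dvd => /eqP; have := ltn_ord s; have := ltn_ord s' => h h' e.
by apply/val_inj; move: e; rewrite !modz_nat !modn_small // => -[].
Qed.

(** The [F s] act as a fundamental domain: the sum of a solution and [F s] lies in the class r + s,
    so it determines s, then [F s], then the solution. All these sums lie in a box of side L + E. *)
Lemma ev_sol_le : (#|ev_sol| * q <= (L + E) ^ 3)%N.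
Proof.
have [F hF] := ev_reps.
pose S := finset.setX ev_sol [set: 'I_q].
pose ad (x : 'I_L) (e : 'I_E.+1) : 'I_(L + E) := insubd (widen_ord (leq_addr E L) x) (x + e)%N.
have adE x e : ad x e = (x + e)%N :> nat.
  by rewrite /ad val_insubd; case: ifP => //; have := ltn_ord x; have := ltn_ord e; lia.
pose f (y : ('I_L * 'I_L * 'I_L) * 'I_q) : 'I_(L + E) * 'I_(L + E) * 'I_(L + E) :=
  (ad y.1.1.1 (F y.2).1.1, ad y.1.1.2 (F y.2).1.2, ad y.1.2 (F y.2).2).
have inj : {in S &, injective f}.
  move=> [[[x1 x2] x3] s] [[[y1 y2] y3] s']; rewrite !inE /= !andbT => hx hy [].
  move=> /(congr1 val) /=; rewrite !adE => e1 /(congr1 val) /=; rewrite !adE => e2.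
  move=> /(congr1 val) /=; rewrite !adE => e3.
  have ss : s = s'.
    apply: ord_dvdz_eq.
    have := rpredB (rpredD hx (hF s)) (rpredD hy (hF s')).
    set A := ev _ _ _ _; set B := ev _ _ _ _; set A' := ev _ _ _ _; set B' := ev _ _ _ _.
    have AB : A + B = A' + B'.
      by rewrite -!evD; congr ev; lia.
    move=> hd; rewrite -rpredN opprB (_ : s'%:Z - s%:Z = A - r + (B - s%:Z) - (A' - r + (B' - s'%:Z))) //.
    by clearbody A B A' B'; clear - AB; lia.
  move: e1 e2 e3; rewrite ss => /addIn e1 /addIn e2 /addIn e3.
  by congr (_, _, _, _); apply/val_inj.
have -> : (#|ev_sol| * q = #|S|)%N by rewrite cardsX cardsT card_ord.
rewrite -(card_in_imset inj); apply: (leq_trans (max_card _)).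
by rewrite !card_prod !card_ord; lia.
Qed.

(** Conversely, subtracting the right [F s] from a point with coordinates in [E, L) gives a
    solution, still in the box since the coordinates of [F s] are between 0 and E. *)
Lemma ev_sol_ge : ((L - E) ^ 3 <= #|ev_sol| * q)%N.
Proof.
have [F hF] := ev_reps.
have key (g : 'I_(L - E) * 'I_(L - E) * 'I_(L - E)) :
    exists y : ('I_L * 'I_L * 'I_L) * 'I_q, [/\ y.1 \in ev_sol,
      (g.1.1 + E = y.1.1.1 + (F y.2).1.1)%N, (g.1.2 + E = y.1.1.2 + (F y.2).1.2)%N
      & (g.2 + E = y.1.2 + (F y.2).2)%N].
  case: g => [[g1 g2] g3]; rewrite /fst /snd.
  pose x : int := ev t (g1 + E)%N%:Z (g2 + E)%N%:Z (g3 + E)%N%:Z - r.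
  have xq : (`|(x %% q)%Z| < q)%N by have := q0; lia.
  pose s := Ordinal xq.
  have hs : (q%:Z %| x - s%:Z)%Z.
    by rewrite -eqz_mod_dvd /= gez0_abs ?modz_mod // modz_ge0 //; have := q0; lia.
  have sub (g : 'I_(L - E)) (e : 'I_E.+1) : exists y : 'I_L, (g + E = y + e)%N.
    have h : (g + E - e < L)%N by have := ltn_ord g; have := ltn_ord e; lia.
    by exists (Ordinal h) => /=; have := ltn_ord e; lia.
  have [y1 e1] := sub g1 (F s).1.1; have [y2 e2] := sub g2 (F s).1.2.
  have [y3 e3] := sub g3 (F s).2.
  exists (y1, y2, y3, s); split=> //; rewrite inE /=.
  have := rpredB hs (hF s).
  have -> : x = ev t y1%:Z y2%:Z y3%:Z + ev t (F s).1.1%:Z (F s).1.2%:Z (F s).2%:Z - r.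
    by rewrite /x e1 e2 e3 !PoszD evD.
  by set A := ev _ _ _ _; set B := ev _ _ _ _; rewrite (_ : _ - _ = A - r) //; ring.
have [f hf] := fin_all_exists key.
have inj : injective f.
  move=> g g' e; have := hf g; have := hf g'; rewrite -e.
  move=> [_ <- <- <-] [_ /addIn e1 /addIn e2 /addIn e3].
  move: g g' e1 e2 e3 {e} => [[? ?] ?] [[? ?] ?] /= e1 e2 e3.
  by congr (_, _, _); apply/val_inj.
have -> : (#|ev_sol| * q = #|finset.setX ev_sol [set: 'I_q]|)%N.
  by rewrite cardsX cardsT card_ord.
have -> : ((L - E) ^ 3 = #|[set f g | g : ('I_(L - E) * 'I_(L - E) * 'I_(L - E))%type]|)%N.
  by rewrite card_imset // !card_prod !card_ord; lia.
apply/subset_leq_card/fintype.subsetP => y /imsetP[g _ ->].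
by rewrite !inE andbT; have [] := hf g; rewrite inE.
Qed.
End EvCount.

(** * Roots of t^3 + 2 modulo p and p^2 *)

Definition croots (m : nat) : {set 'I_m} := [set t : 'I_m | (m %| t ^ 3 + 2)%N].

Lemma card_croots_prime (p : nat) : prime p -> (#|croots p| <= 3)%N.
Proof.
move=> pp; pose P : {poly 'F_p} := 'X^3 + 2%:R%:P.
have sP : size P = 4.
  by rewrite size_polyDl size_polyXn // (leq_ltn_trans (size_polyC_leq1 _)).
pose rs := [seq (nat_of_ord t)%:R : 'F_p | t <- enum (croots p)].
have : (size rs < size P)%N.
  apply: max_poly_roots; first by rewrite -size_poly_eq0 sP.
    apply/allP => x /mapP[t]; rewrite mem_enum inE => ht ->.
    rewrite rootE hornerD hornerXn hornerC -natrX -natrD -(dvdn_pcharf (pchar_Fp pp)).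
    exact: ht.
  rewrite map_inj_uniq ?enum_uniq // => t t' /(congr1 val) /=.
  rewrite !val_Fp_nat // !modn_small ?ltn_ord // => e; exact/val_inj.
by rewrite sP size_map -cardE.
Qed.

(** For p > 3 the polynomial is separable, so reduction modulo p is injective on roots modulo p^2:
    if t' = t modulo p, the cofactor of t' - t in t'^3 - t^3 is 3 t^2, invertible modulo p. *)
Lemma card_croots_sqr (p : nat) : prime p -> (3 < p)%N ->
  (#|croots (p ^ 2)| <= 3)%N.
Proof.
move=> pp p3; have p0 := prime_gt0 pp.
apply: leq_trans (card_croots_prime pp).
pose f (t : 'I_(p ^ 2)) : 'I_p := Ordinal (ltn_pmod t p0).
have inj : {in croots (p ^ 2) &, injective f}.
  move=> t t'; rewrite !inE => ht ht' /(congr1 val) /= e.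
  have lt := ltn_ord t; have lt' := ltn_ord t'.
  wlog le : t t' ht ht' e lt lt' / (t <= t')%N.
    by move=> G; have [l|l] := leqP t t'; [|symmetry]; apply: G => //; rewrite ltnW.
  apply/val_inj/eqP; rewrite eqn_leq le /=.
  have e' : (p %| t' - t)%N by rewrite -eqn_mod_dvd //; apply/eqP.
  have pt : (p %| t ^ 3 + 2)%N by apply: dvdn_trans ht; rewrite dvdn_exp.
  have pn2 : ~~ (p %| 2)%N by apply/negP => /dvdn_leq; clear -p3; lia.
  have pnt : ~~ (p %| t)%N.
    by apply/negP => h; move: pt; rewrite dvdn_addr ?dvdn_exp // (negPf pn2).
  have co : coprime (p ^ 2) (t' ^ 2 + t' * t + t ^ 2).
    rewrite coprimeXl // prime_coprime //.
    have -> : (t' ^ 2 + t' * t + t ^ 2 = (t' - t) * (t' + 2 * t) + 3 * t ^ 2)%N.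
      have [d ->] : exists d, nat_of_ord t' = (t + d)%N.
        by exists (t' - t)%N; rewrite subnKC.
      by rewrite addKn; clear; lia.
    rewrite (dvdn_addr _ (dvdn_mulr _ e')) Euclid_dvdM // Euclid_dvdX // andbT negb_or pnt andbT.
    by apply/negP => /dvdn_leq; clear -p3; lia.
  have : (p ^ 2 %| (t' - t) * (t' ^ 2 + t' * t + t ^ 2))%N.
    have -> : ((t' - t) * (t' ^ 2 + t' * t + t ^ 2) = (t' ^ 3 + 2) - (t ^ 3 + 2))%N.
      have [d ->] : exists d, nat_of_ord t' = (t + d)%N.
        by exists (t' - t)%N; rewrite subnKC.
      by rewrite addKn; clear; lia.
    by rewrite dvdn_sub.
  rewrite Gauss_dvdl // => /dvdn_leq h.
  rewrite leqNgt; apply/negP => l; move: h; rewrite subn_gt0 l => /(_ isT).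
  by rewrite leqNgt (leq_ltn_trans (leq_subr _ _)).
rewrite -(card_in_imset inj); apply/subset_leq_card/fintype.subsetP => x /imsetP[t].
rewrite !inE => ht -> /=.
have : (p %| t ^ 3 + 2)%N by apply: dvdn_trans ht; rewrite dvdn_exp.
by move=> h; rewrite /dvdn -modnDml modnXm modnDml.
Qed.

Lemma card_box_packing (L s : nat) (S : {set 'I_L * 'I_L * 'I_L}) : (0 < s)%N ->
  (forall x y, x \in S -> y \in S -> `|x.1.1%:Z - y.1.1%:Z| < s%:Z ->
     `|x.1.2%:Z - y.1.2%:Z| < s%:Z -> `|x.2%:Z - y.2%:Z| < s%:Z -> x = y) ->
  (#|S| <= (L %/ s).+1 ^ 3)%N.
Proof.
move=> s0 h; have hd (x : 'I_L) : (x %/ s < (L %/ s).+1)%N.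
  by rewrite ltnS leq_div2r // ltnW.
pose f (x : 'I_L * 'I_L * 'I_L) := (Ordinal (hd x.1.1), Ordinal (hd x.1.2), Ordinal (hd x.2)).
have inj : {in S &, injective f}.
  move=> x y hx hy [e1 e2 e3]; apply: h => //.
  - by have := divn_eq x.1.1 s; have := divn_eq y.1.1 s; rewrite e1;
      have := ltn_pmod x.1.1 s0; have := ltn_pmod y.1.1 s0; clear; lia.
  - by have := divn_eq x.1.2 s; have := divn_eq y.1.2 s; rewrite e2;
      have := ltn_pmod x.1.2 s0; have := ltn_pmod y.1.2 s0; clear; lia.
  - by have := divn_eq x.2 s; have := divn_eq y.2 s; rewrite e3;
      have := ltn_pmod x.2 s0; have := ltn_pmod y.2 s0; clear; lia.
rewrite -(card_in_imset inj); apply: (leq_trans (max_card _)).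
by rewrite !card_prod !card_ord; lia.
Qed.

Lemma card_bigcup_sum (I T : finType) (A : {set I}) (F : I -> {set T}) :
  (#|\bigcup_(i in A) F i| <= \sum_(i in A) #|F i|)%N.
Proof.
elim/big_rec2: _ => [|i y U iA IH]; first by rewrite cards0.
by apply: leq_trans (leq_card_setU _ _) _; rewrite leq_add.
Qed.

Lemma card_bigcup_le (I T : finType) (A : {set I}) (F : I -> {set T}) (n : nat) :
  (forall i, i \in A -> (#|F i| <= n)%N) -> (#|\bigcup_(i in A) F i| <= #|A| * n)%N.
Proof.
by move=> h; rewrite (leq_trans (card_bigcup_sum _ _)) // -sum_nat_const leq_sum.
Qed.

Lemma crootsP (m : nat) (t : 'I_m) :
  (t \in croots m) = (m%:Z %| t%:Z ^+ 3 + 2)%Z.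
Proof. by rewrite inE dvdzE; congr (_ %| _)%N; lia. Qed.

Lemma croots_lift (m : nat) (t : int) : (0 < m)%N -> (m%:Z %| t ^+ 3 + 2)%Z ->
  exists2 s : 'I_m, s \in croots m & (m%:Z %| t - s%:Z)%Z.
Proof.
move=> m0 ht; have lt : (`|(t %% m)%Z| < m)%N by lia.
have ds : (m%:Z %| t - (`|(t %% m)%Z|)%:Z)%Z.
  by rewrite -eqz_mod_dvd gez0_abs ?modz_mod // modz_ge0 //; lia.
exists (Ordinal lt) => //; rewrite crootsP /=.
set s : int := _%:Z in ds *.
rewrite (_ : s ^+ 3 + 2 = t ^+ 3 + 2 - (t - s) * (t ^+ 2 + t * s + s ^+ 2)); last by ring.
by rewrite rpredB // dvdz_mulr.
Qed.

Lemma dvdz_ev_congr (m t s a b c : int) :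
  (m %| t - s)%Z -> (m %| ev t a b c)%Z -> (m %| ev s a b c)%Z.
Proof.
move=> h ht; rewrite (_ : ev s a b c = ev t a b c - (t - s) * (b + c * (t + s))).
  by rewrite rpredB // dvdz_mulr.
by rewrite /ev; ring.
Qed.

(** * Roots attached to an element, and norms divisible by p^2 *)

Section NrmPrime.
Variable p : nat.
Hypothesis p_prime : prime p.

Definition evroots (a b c : int) : {set 'I_p} :=
  [set t in croots p | (p%:Z %| ev t%:Z a b c)%Z].

Lemma card_evroots_le3 a b c : (#|evroots a b c| <= 3)%N.
Proof.
apply: leq_trans (card_croots_prime p_prime).
by apply/subset_leq_card/fintype.subsetP => t; rewrite inE => /andP[].
Qed.

Lemma card_evroots0 a b c : ~~ (p%:Z %| nrm a b c)%Z -> #|evroots a b c| = 0%N.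
Proof.
move=> h; apply: eq_card0 => t; rewrite [LHS]inE; apply/negP => /andP[].
by rewrite crootsP => ht he; rewrite (dvdz_nrm ht he) in h.
Qed.

Lemma dvdz_sqr_nrm_all a b c : (p%:Z %| a)%Z -> (p%:Z %| b)%Z -> (p%:Z %| c)%Z ->
  ((p ^ 2)%N%:Z %| nrm a b c)%Z.
Proof.
move=> /dvdzP[x ->] /dvdzP[y ->] /dvdzP[z ->]; apply/dvdzP.
exists (nrm x y z * p%:Z); rewrite (_ : (p ^ 2)%N%:Z = p%:Z ^+ 2); last by lia.
by rewrite /nrm; ring.
Qed.

(** The degenerate case would make p^2 divide the norm; outside it, elimination produces a root and
    shows that it is unique. *)
Lemma card_evroots1 a b c : (p%:Z %| nrm a b c)%Z ->
  ~~ ((p ^ 2)%N%:Z %| nrm a b c)%Z -> #|evroots a b c| = 1%N.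
Proof.
move=> h h2; have p0 := prime_gt0 p_prime.
have [he|he] := boolP (p%:Z %| a * c - b ^+ 2)%Z.
  case/negP: h2; have [[*]|[t [*]]] := nrm_degenerate p_prime he h.
    exact: dvdz_sqr_nrm_all.
  exact: (@dvdz_sqr_nrm p p_prime a b c t).
have [t [ht hev]] : exists t, (p%:Z %| t ^+ 3 + 2)%Z /\ (p%:Z %| ev t a b c)%Z.
  by have := @nrm_root p p_prime a b c 1 he; rewrite expn1 => /(_ h).
have [s hs hts] := croots_lift p0 ht; have hes := dvdz_ev_congr hts hev.
apply/eqP/cards1P; exists s; apply/finset.setP => u; rewrite [LHS]inE finset.in_set1.
apply/andP/eqP => [[hu heu]|->//].
move: hs hu; rewrite !crootsP => hs hu.
exact: (ord_dvdz_eq (nrm_root_uniq p_prime he hu heu hs hes)).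
Qed.

Section SqrCount.
Variables (W L s : nat) (A B C : int).
Hypotheses (p3 : (3 < p)%N) (coW : coprime W p) (s0 : (0 < s)%N).
Hypothesis hs : (13 * s.-1 ^ 3 < p ^ 2)%N.

(* Two points of the subgroup in the same small cube differ by an element whose
   norm is a multiple of [p ^ 2] smaller than [p ^ 2], hence zero. *)
Lemma card_subgroup_packing (G : int -> int -> int -> bool) :
  (forall a b c a' b' c', G a b c -> G a' b' c' -> G (a - a') (b - b') (c - c')) ->
  (forall a b c, G a b c -> ((p ^ 2)%N%:Z %| nrm a b c)%Z) ->
  (#|[set x : 'I_L * 'I_L * 'I_L | G (A + W%:Z * x.1.1%:Z)%R
        (B + W%:Z * x.1.2%:Z)%R (C + W%:Z * x.2%:Z)%R]| <= (L %/ s).+1 ^ 3)%N.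
Proof.
move=> GB GN; apply: card_box_packing => // x y; rewrite !inE => hx hy h1 h2 h3.
have := GN _ _ _ (GB _ _ _ _ _ _ hx hy).
rewrite (_ : nrm _ _ _ = W%:Z ^+ 3 *
  nrm (x.1.1%:Z - y.1.1%:Z) (x.1.2%:Z - y.1.2%:Z) (x.2%:Z - y.2%:Z)); last first.
  by rewrite /nrm; ring.
rewrite Gauss_dvdzr; last by rewrite coprimezE absz_nat abszX absz_nat coprimeXl // coprimeXr // coprime_sym.
move/(nrm_small_eq0 hs) => []; try (move: h1 h2 h3; clear -s0; lia).
move: x y {hx hy h1 h2 h3} => [[x1 x2] x3] [[y1 y2] y3] /= h1 h2 h3.
by congr (_, _, _); apply/val_inj => /=; clear -h1 h2 h3; lia.
Qed.

(** The elements with norm divisible by p^2 lie in 7 = 3 + 3 + 1 subgroups where all norms are: one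
    for each root modulo p^2, one degenerate subgroup for each root modulo p, and the multiples of
    p. *)
Lemma card_sqr_dvd_nrm :
  (#|[set x : 'I_L * 'I_L * 'I_L | ((p ^ 2)%N%:Z %| nrm (A + W%:Z * x.1.1%:Z)%R
        (B + W%:Z * x.1.2%:Z)%R (C + W%:Z * x.2%:Z)%R)%Z]|
     <= 7 * (L %/ s).+1 ^ 3)%N.
Proof.
have p0 := prime_gt0 p_prime.
have p20 : (0 < p ^ 2)%N by rewrite expn_gt0 p0.
pose box (G : int -> int -> int -> bool) :=
  [set x : 'I_L * 'I_L * 'I_L | G (A + W%:Z * x.1.1%:Z) (B + W%:Z * x.1.2%:Z)
        (C + W%:Z * x.2%:Z)].
pose G1 (t : 'I_(p ^ 2)) a b c := ((p ^ 2)%N%:Z %| ev t%:Z a b c)%Z.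
pose G2 (t : 'I_p) a b c := (p%:Z %| b - c * t%:Z)%Z && (p%:Z %| a - c * t%:Z ^+ 2)%Z.
pose G3 a b c := [&& (p%:Z %| a)%Z, (p%:Z %| b)%Z & (p%:Z %| c)%Z].
have sub : [set x : 'I_L * 'I_L * 'I_L | ((p ^ 2)%N%:Z %| nrm (A + W%:Z * x.1.1%:Z)
        (B + W%:Z * x.1.2%:Z) (C + W%:Z * x.2%:Z))%Z] \subset
    (\bigcup_(t in croots (p ^ 2)) box (G1 t)) :|:
    (\bigcup_(t in croots p) box (G2 t)) :|: box G3.
  apply/fintype.subsetP => x; rewrite finset.in_set.
  set a := A + _; set b := B + _; set c := C + _ => hN.
  have [he|he] := boolP (p%:Z %| a * c - b ^+ 2)%Z.
    have hp : (p%:Z %| nrm a b c)%Z.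
      by apply: dvdz_trans hN; rewrite dvdzE /= dvdn_exp.
    have [[ha hb hc]|[t [ht hb hc]]] := nrm_degenerate p_prime he hp.
      by apply/finset.setUP; right; rewrite inE; apply/and3P.
    have [s' hs' hts] := croots_lift p0 ht.
    apply/finset.setUP; left; apply/finset.setUP; right; apply/finset.bigcupP; exists s' => //.
    rewrite inE -/a -/b -/c; apply/andP; split.
      rewrite (_ : _ - _ = b - c * t + (t - s'%:Z) * c); last by ring.
      by rewrite rpredD // dvdz_mulr.
    rewrite (_ : _ - _ = a - c * t ^+ 2 + (t - s'%:Z) * (c * (t + s'%:Z))); last by ring.
    by rewrite rpredD // dvdz_mulr.
  have [t [ht hev]] := nrm_root p_prime he hN.
  have [s' hs' hts] := croots_lift p20 ht.
  apply/finset.setUP; left; apply/finset.setUP; left; apply/finset.bigcupP; exists s' => //.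
  by rewrite finset.in_set; exact: (dvdz_ev_congr hts hev).
apply: leq_trans (subset_leq_card sub) _.
apply: leq_trans (leq_card_setU _ _) _.
rewrite (_ : 7 = 3 + 3 + 1)%N // !mulnDl mul1n; apply: leq_add.
  apply: leq_trans (leq_card_setU _ _) _; apply: leq_add.
    apply: leq_trans (card_bigcup_le (n := (L %/ s).+1 ^ 3) _) _; last first.
      by rewrite leq_mul2r card_croots_sqr ?orbT.
    move=> t ht; apply: card_subgroup_packing => [a b c a' b' c'|a b c].
      by rewrite /G1 evB => h1 h2; rewrite rpredB.
    by rewrite crootsP in ht; exact: dvdz_nrm ht.
  apply: leq_trans (card_bigcup_le (n := (L %/ s).+1 ^ 3) _) _; last first.
    by rewrite leq_mul2r card_croots_prime ?orbT.
  move=> t ht; apply: card_subgroup_packing => [a b c a' b' c'|a b c].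
    move=> /andP[h1 h2] /andP[h3 h4]; apply/andP; split.
      by have := rpredB h1 h3; rewrite (_ : _ - _ - _ = b - b' - (c - c') * t%:Z) //; ring.
    by have := rpredB h2 h4; rewrite (_ : _ - _ - _ = a - a' - (c - c') * t%:Z ^+ 2) //; ring.
  by case/andP; apply: (dvdz_sqr_nrm p_prime); rewrite -crootsP.
apply: card_subgroup_packing => [a b c a' b' c'|a b c].
  by move=> /and3P[h1 h2 h3] /and3P[h4 h5 h6]; apply/and3P; split; rewrite rpredB.
by case/and3P; apply: dvdz_sqr_nrm_all.
Qed.

End SqrCount.
End NrmPrime.

(** * Chebyshev's bound and sums over primes *)

Lemma prod_primes_dvd (N m n : nat) :
  (forall p, (m <= p < n)%N -> prime p -> (p %| N)%N) ->
  (\prod_(m <= p < n | prime p) p %| N)%N.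
Proof.
elim: n => [|n IH] h; first by rewrite big_geq // dvd1n.
have [lmn|lnm] := leqP m n; last by rewrite big_geq // dvd1n.
rewrite big_mkcond big_nat_recr //= -big_mkcond /=.
have hn : (\prod_(m <= p < n | prime p) p %| N)%N.
  by apply: IH => p /andP[mp pn]; apply: h; rewrite mp ltnW.
case: ifP => pn; last by rewrite muln1.
rewrite Gauss_dvd ?hn ?h ?lmn ?ltnS ?leqnn //.
rewrite coprime_sym prime_coprime // big_nat_cond.
elim/big_rec: _ => [|i x /andP[/andP[_ li] pi] hx]; first by rewrite dvdn1; case: eqP pn => // ->.
by rewrite Euclid_dvdM // negb_or hx dvdn_prime2 // andbT gtn_eqF.
Qed.

(** The induction of Erdős: for n = 2 m + 1, the primes from m + 2 to n divide the binomial
    coefficient of n over m, which is at most 4^m since it occurs twice in the expansion of (1 +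
    1)^n. An even n > 2 adds no prime. *)
Lemma primorial_le (n : nat) : (\prod_(0 <= p < n.+1 | prime p) p <= 4 ^ n)%N.
Proof.
elim/ltn_ind: n => -[|[|[|n]]] IH; try by rewrite unlock.
have [] := boolP (odd n.+3) => on; last first.
  rewrite big_mkcond big_nat_recr //= -big_mkcond /=.
  rewrite ifF ?muln1; last first.
    by apply/negP => /even_prime [|]; [lia|rewrite (negPf on)].
  by apply: leq_trans (IH n.+2 _) _; rewrite ?leq_exp2l.
have [m em] : exists m, n.+3 = m.*2.+1.
  by exists n.+3./2; rewrite -[LHS]odd_double_half on.
rewrite em (big_cat_nat (n := m.+2)) //=; last by lia.
rewrite (_ : 4 ^ m.*2.+1 = 4 ^ m.+1 * 4 ^ m)%N; last by rewrite -expnD; congr expn; lia.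
apply: leq_mul; first by apply: IH; lia.
have b0 : (0 < 'C(m.*2.+1, m))%N by rewrite bin_gt0; lia.
apply: (@leq_trans 'C(m.*2.+1, m)).
  apply: dvdn_leq => //; apply: prod_primes_dvd => p /andP[mp pm] pp.
  have : (p %| 'C(m.*2.+1, m) * (m`! * (m.*2.+1 - m)`!))%N.
    by rewrite bin_fact; [rewrite dvdn_fact // prime_gt0 //|lia].
  have nf k : (k < p)%N -> ~~ (p %| k`!)%N.
    elim: k => [|k IHk] kp; first by rewrite fact0 dvdn1; case: eqP pp => // ->.
    rewrite factS Euclid_dvdM // negb_or IHk ?andbT; last by lia.
    by apply/negP => /dvdn_leq; lia.
  have /negPf n1 : ~~ (p %| m`!)%N by apply: nf; lia.
  have /negPf n2 : ~~ (p %| (m.*2.+1 - m)`!)%N by apply: nf; lia.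
  by rewrite !Euclid_dvdM // n1 n2 !orbF.
have : ('C(m.*2.+1, m) + 'C(m.*2.+1, m.+1) <= 2 ^ m.*2.+1)%N.
  have := expnDn 1 1 m.*2.+1; rewrite addn1 => ->.
  have l1 : (m < m.*2.+2)%N by lia. have l2 : (m.+1 < m.*2.+2)%N by lia.
  rewrite (bigD1 (Ordinal l1)) //= (bigD1 (Ordinal l2)) /=; last first.
    by apply/eqP => -[]; lia.
  by rewrite !exp1n !muln1; lia.
rewrite -(@bin_sub _ m.+1); last by lia.
have -> : (m.*2.+1 - m.+1 = m)%N by lia.
have -> : (2 ^ m.*2.+1 = 2 * 4 ^ m)%N by rewrite expnS -mul2n expnM.
lia.
Qed.

Section RealSums.
Context {R : realType}.
Implicit Types (f a : nat -> R) (n : nat) (C : R).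

Lemma ln_le_sub1 (x : R) : 0 < x -> ln x <= x - 1.
Proof. by move=> x0; have := @le_ln1Dx R (x - 1); rewrite addrCA subrr addr0; apply; lra. Qed.

Lemma ln_prodn (I : Type) (r : seq I) (P : pred I) (F : I -> nat) :
  (forall i, P i -> (0 < F i)%N) ->
  ln ((\prod_(i <- r | P i) F i)%N%:R : R) = \sum_(i <- r | P i) ln ((F i)%:R : R).
Proof.
move=> F0; apply: proj2 (_ : (0 < \prod_(i <- r | P i) F i)%N /\ _).
elim/big_rec2: _ => [|i x y Pi [y0 e]]; first by rewrite ln1.
by rewrite muln_gt0 F0 // y0 natrM lnM ?e // posrE ltr0n // F0.
Qed.

Lemma ln_nat_decomp (n B : nat) : (0 < n)%N -> (n <= B)%N ->
  ln (n%:R : R) = \sum_(0 <= p < B.+1 | prime p) (logn p n)%:R * ln (p%:R : R).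
Proof.
move=> n0 nB; rewrite -[in LHS](partnT n0) (widen_partn _ nB) /=.
rewrite (eq_bigl (fun=> true)) // ln_prodn => [|p _]; last first.
  by case: p => [|p]; rewrite ?expn_gt0 // logn0.
rewrite [RHS]big_mkcond; apply: eq_bigr => p _.
case: ifP => pp; last by rewrite lognE pp expn0 ln1.
by rewrite natrX lnXn ?mulr_natl // ltr0n prime_gt0.
Qed.

Lemma theta_le n : \sum_(0 <= p < n.+1 | prime p) ln (p%:R : R) <= ln 4 * n%:R.
Proof.
rewrite -ln_prodn; last by move=> p /prime_gt0.
have -> : ln 4 * n%:R = ln ((4 ^ n)%N%:R : R) by rewrite natrX lnXn // mulr_natr.
by rewrite ler_ln ?posrE ?ltr0n ?expn_gt0 ?ler_nat ?primorial_le //;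
   apply: prodn_cond_gt0 => p /prime_gt0.
Qed.

Lemma abel_le a f C : (forall n, \sum_(0 <= i < n) a i <= C * n%:R) ->
  (forall i, f i.+1 <= f i) -> (forall i, 0 <= f i) ->
  forall n, \sum_(0 <= i < n) a i * f i <= C * \sum_(0 <= i < n) f i.
Proof.
move=> ha fd f0 [|n]; first by rewrite !big_geq // mulr0.
(* The induction keeps the boundary term of the summation by parts. *)
have key m : (C * m.+1%:R - \sum_(0 <= i < m.+1) a i) * f m <=
    C * (\sum_(0 <= i < m.+1) f i) - \sum_(0 <= i < m.+1) a i * f i.
  elim: m => [|m IH]; first by rewrite !big_nat1; lra.
  rewrite !(big_nat_recr m.+1) //=.
  have := ha m.+1; have := fd m; move: IH.
  rewrite -(natr1 m.+1).
  set A := \sum_(0 <= i < m.+1) a i; set u := f m.+1; set v := f m => IH uv hA.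
  have : (C * m.+1%:R - A) * u <= (C * m.+1%:R - A) * v.
    by apply: ler_wpM2l => //; lra.
  by move: IH; nra.
have : 0 <= (C * n.+1%:R - \sum_(0 <= i < n.+1) a i) * f n.
  by rewrite mulr_ge0 // subr_ge0.
by move/le_trans => /(_ _ (key n)); lra.
Qed.

(** Abel summation from [theta_le]. It serves for the weights i^(-2/3), from the equidistribution
    error, and 1 / i, from counting tuples of primes. *)
Lemma prime_sum_le f n : (forall i, f i.+2 <= f i.+1) -> (forall i, 0 <= f i.+1) ->
  \sum_(0 <= p < n.+1 | prime p) ln (p%:R : R) * f p <=
    ln 4 * \sum_(1 <= i < n.+1) f i.
Proof.
move=> fd f0; pose a i : R := if prime i.+1 then ln (i.+1%:R) else 0.
have -> : \sum_(0 <= p < n.+1 | prime p) ln (p%:R : R) * f p =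
    \sum_(0 <= i < n) a i * f i.+1.
  rewrite big_mkcond big_nat_recl //= add0r; apply: eq_bigr => i _.
  by rewrite /a; case: ifP => // _; rewrite mul0r.
rewrite big_add1 /=; apply: (@abel_le a (fun i => f i.+1)) => // m.
have := theta_le m; rewrite big_mkcond big_nat_recl //= add0r; exact: le_trans.
Qed.

Lemma harmonic_le n : (0 < n)%N -> \sum_(1 <= i < n.+1) (i%:R^-1 : R) <= 1 + ln n%:R.
Proof.
elim: n => // -[|n] IH _; first by rewrite big_nat1 ln1; lra.
rewrite big_nat_recr //=.
have := IH isT.
have h1 : (0 : R) < n.+1%:R by rewrite ltr0n.
have h2 : (0 : R) < n.+2%:R by rewrite ltr0n.
have := @ln_le_sub1 (n.+1%:R / n.+2%:R) (divr_gt0 h1 h2).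
rewrite ln_div ?posrE //.
have -> : n.+1%:R / n.+2%:R - 1 = - (n.+2%:R^-1) :> R.
  by rewrite -[X in _ - X](divff (lt0r_neq0 h2)) -mulrBl -(natr1 n.+1) opprD addNKr mulN1r.
set x := ln _; set y := ln _; set z := _^-1; set S := \sum_(_ <= _ < _) _.
clearbody x y z S; lra.
Qed.

Definition cbrt (x : R) : R := x `^ 3^-1.

Lemma cbrtK x : 0 <= x -> cbrt x ^+ 3 = x.
Proof.
move=> x0; rewrite /cbrt -powR_mulrn ?powR_ge0 // -powRrM mulVf ?powRr1 //.
Qed.

Lemma cbrt_gt0 x : 0 < x -> 0 < cbrt x.
Proof. exact: powR_gt0. Qed.

Lemma cbrt_le x y : 0 <= x -> x <= y -> cbrt x <= cbrt y.
Proof. by move=> x0 xy; apply: ge0_ler_powR; rewrite ?nnegrE ?invr_ge0 //; apply: le_trans xy. Qed.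

(** Telescoping: consecutive cube roots v <= u satisfy 1 = u^3 - v^3 <= 3 u^2 (u - v). *)
Lemma sum_cbrt_le n : \sum_(1 <= i < n.+1) ((cbrt i%:R ^+ 2)^-1 : R) <= 3 * cbrt n%:R.
Proof.
elim: n => [|n IH]; first by rewrite big_geq // mulr_ge0 // powR_ge0.
rewrite big_nat_recr //=; apply: (le_trans (lerD IH (lexx _))).
have hu := @cbrt_gt0 n.+1%:R (ltr0Sn _ _).
have hv : 0 <= cbrt n%:R by exact: powR_ge0.
have eu := @cbrtK n.+1%:R (ler0n _ _); have ev := @cbrtK n%:R (ler0n _ _).
have uv : cbrt n%:R <= cbrt n.+1%:R by apply: cbrt_le; rewrite ?ler_nat.
move: hu hv eu ev uv; rewrite -natr1; set u := cbrt (_ + _); set v := cbrt _ => hu hv eu ev uv.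
have u2 : 0 < u ^+ 2 by rewrite exprn_gt0.
rewrite -lerBrDl -(ler_pM2r u2) mulVf ?lt0r_neq0 //.
have : u ^+ 3 - v ^+ 3 = 1 by rewrite eu ev; lra.
have -> : u ^+ 3 - v ^+ 3 = (u - v) * (u ^+ 2 + u * v + v ^+ 2) by ring.
move=> h; have d0 : 0 <= u - v by lra.
have : (u - v) * (u ^+ 2 + u * v + v ^+ 2) <= (u - v) * (3 * u ^+ 2).
  by apply: ler_wpM2l => //; nra.
by rewrite h => /le_trans; apply; lra.
Qed.

End RealSums.

(** With M = W L, the first coordinate is between 2 M and 3 M and the others between 0 and M, so
    that 6 = 8 - 2 and 49 = 27 + 4 + 18. *)
Lemma box_bounds (W L : nat) (x : 'I_L * 'I_L * 'I_L) : (0 < W)%N ->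
  6 * ((W * L) ^ 3)%N%:Z <=
    nrm (1 + 2 * (W * L)%N%:Z + W%:Z * x.1.1%:Z) (0 + W%:Z * x.1.2%:Z)
      (0 + W%:Z * x.2%:Z) <= 49 * ((W * L) ^ 3)%N%:Z.
Proof.
move=> W0; case: x => [[x1 x2] x3] /=.
have hM (y : 'I_L) : 0 <= W%:Z * y%:Z /\ W%:Z * y%:Z + 1 <= (W * L)%N%:Z.
  have := ltn_ord y; split; first by rewrite mulr_ge0.
  by rewrite -PoszM -[1]/(Posz 1) -PoszD lez_nat addn1 ltn_pmul2l.
have [a0 a1] := hM x1; have [b0 b1] := hM x2; have [c0 c1] := hM x3.
rewrite !add0r [((W * L) ^ 3)%N%:Z](_ : _ = (W * L)%N%:Z ^+ 3) /nrm; last by rewrite -rmorphXn.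
move: a0 a1 b0 b1 c0 c1; move: (W%:Z * x1%:Z) (W%:Z * x2%:Z) (W%:Z * x3%:Z).
move: (W * L)%N%:Z => M a b c a0 a1 b0 b1 c0 c1.
have M0 : 0 <= M by lia.
have b3 : b ^+ 3 <= M ^+ 3 by apply: lerXn2r; rewrite ?nnegrE //; lia.
have c3 : c ^+ 3 <= M ^+ 3 by apply: lerXn2r; rewrite ?nnegrE //; lia.
have b30 : 0 <= b ^+ 3 by rewrite exprn_ge0.
have c30 : 0 <= c ^+ 3 by rewrite exprn_ge0.
set A := 1 + 2 * M + a.
have A1 : (2 * M) ^+ 3 <= A ^+ 3 by apply: lerXn2r; rewrite ?nnegrE /A; lia.
have A2 : A ^+ 3 <= (3 * M) ^+ 3 by apply: lerXn2r; rewrite ?nnegrE /A; lia.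
have A0 : 0 <= A by rewrite /A; lia.
have abc0 : 0 <= A * b * c by rewrite !mulr_ge0.
have abc : A * b * c <= (3 * M) * M * M.
  by apply: ler_pM; rewrite ?mulr_ge0 //; [apply: ler_pM => //; rewrite /A|]; lia.
move: A1 A2 abc0 abc; rewrite (_ : (2 * M) ^+ 3 = 8 * M ^+ 3); last by ring.
rewrite (_ : (3 * M) ^+ 3 = 27 * M ^+ 3); last by ring.
rewrite (_ : 3 * M * M * M = 3 * M ^+ 3); last by ring.
rewrite -[6 * A * b * c](_ : 6 * (A * b * c) = _); last by ring.
move: (M ^+ 3) (A ^+ 3) (b ^+ 3) (c ^+ 3) (A * b * c) b3 c3 b30 c30.
by clear; lia.
Qed.

Lemma nrm_coprime (p W : nat) (a b c : int) : prime p -> (p %| W)%N ->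
  ~~ (p%:Z %| nrm (1 + W%:Z * a) (0 + W%:Z * b) (0 + W%:Z * c))%Z.
Proof.
move=> pp pW; apply/negP => h.
have pW' : (p%:Z %| W%:Z)%Z by rewrite dvdzE.
have : (p%:Z %| 1%R)%Z.
  rewrite (_ : 1 = nrm (1 + W%:Z * a) (0 + W%:Z * b) (0 + W%:Z * c) - W%:Z *
    (a * (3 + 3 * (W%:Z * a) + (W%:Z * a) ^+ 2) - 2 * b * (W%:Z * b) ^+ 2
     + 4 * c * (W%:Z * c) ^+ 2 + 6 * (1 + W%:Z * a) * b * (W%:Z * c))).
    by rewrite rpredB // dvdz_mulr.
  by rewrite /nrm; ring.
by rewrite dvdzE /= dvdn1; case: eqP pp => // ->.
Qed.

Lemma cbrt_floor (c n : nat) : (0 < c)%N -> (0 < n)%N ->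
  exists m : nat, (c * m ^ 3 < n)%N /\ (n <= c * m.+1 ^ 3)%N.
Proof.
move=> c0 n0; have ex : exists m, (n <= c * m.+1 ^ 3)%N.
  exists n; apply: (@leq_trans (n.+1 ^ 3)); last by rewrite leq_pmull.
  by apply: leq_trans (leqnSn n) _; rewrite -{1}(expn1 n.+1) leq_exp2l.
case: (ex_minnP ex) => m hm hmin; exists m; split=> //.
case: m hm hmin => [|m] hm hmin; first by rewrite exp0n // muln0.
by rewrite ltnNge; apply/negP => /hmin; rewrite ltnn.
Qed.

Section MertensLemmas.
Context {R : realType}.

Lemma sum_inv_sqr_le (z n : nat) : (0 < z)%N ->
  \sum_(0 <= i < n | (z < i)%N) ((i%:R ^+ 2)^-1 : R) <= z%:R^-1.
Proof.
move=> z0; have zR : (0 : R) < z%:R by rewrite ltr0n.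
have key k : \sum_(0 <= i < (z + k).+1 | (z < i)%N) ((i%:R ^+ 2)^-1 : R) <=
    z%:R^-1 - (z + k)%:R^-1.
  elim: k => [|k IH].
    rewrite addn0 subrr big_nat_cond big1 // => i /andP[/andP[_ h] h'].
    by move: h h'; rewrite ltnS leqNgt => /negPf->.
  rewrite addnS big_mkcond big_nat_recr //= -big_mkcond /= ifT; last by lia.
  apply: (le_trans (lerD IH (lexx _))).
  have h0 : (0 : R) < (z + k)%:R by rewrite ltr0n; lia.
  rewrite -(natr1 (z + k)); move: ((z + k)%:R : R) h0 => y h0.
  have y1 : 0 < y + 1 by lra.
  rewrite -addrA lerD2l -subr_ge0.
  have -> : - (y + 1)^-1 - (- y^-1 + ((y + 1) ^+ 2)^-1) = (y * (y + 1) ^+ 2)^-1.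
    by field; rewrite (gt_eqF h0) (gt_eqF y1).
  by rewrite invr_ge0 mulr_ge0 ?sqr_ge0 // ltW.
have [nz|zn] := leqP n z.
  rewrite big_nat_cond big1 ?invr_ge0 ?ltW // => i /andP[/andP[_ h] h'].
  by move: (leq_trans h nz); rewrite ltnNge ltnW.
have := key (n - z.+1)%N; rewrite (_ : (z + (n - z.+1)).+1 = n); last by lia.
by move/le_trans; apply; rewrite gerBl invr_ge0.
Qed.

Lemma sum_le_const (V n : nat) :
  \sum_(0 <= i < n | (0 < i <= V)%N) (1 : R) <= V%:R.
Proof.
rewrite (_ : \sum_(0 <= i < n | _) 1 = (\sum_(0 <= i < n | (0 < i <= V)%N) 1)%N%:R :> R);
  last by rewrite natr_sum.
rewrite ler_nat; suff -> : (\sum_(0 <= i < n | (0 < i <= V)%N) 1 = minn n.-1 V)%N by rewrite geq_minr.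
elim: n => [|n IH]; first by rewrite big_geq // min0n.
rewrite big_mkcond big_nat_recr //= -big_mkcond /= IH.
by case: ifP => ?; lia.
Qed.

Lemma cbrt_le_of_cube (x y : R) : 0 <= x -> 0 <= y -> x <= y ^+ 3 -> cbrt x <= y.
Proof.
move=> x0 y0; rewrite -{1}(cbrtK x0) ler_pXn2r // nnegrE //; exact: powR_ge0.
Qed.

Lemma le_cbrt_of_cube (x y : R) : 0 <= x -> 0 <= y -> y ^+ 3 <= x -> y <= cbrt x.
Proof.
move=> x0 y0; rewrite -{1}(cbrtK x0) ler_pXn2r // nnegrE //; exact: powR_ge0.
Qed.

Lemma cube_shift_le (L E N : nat) : ((L - E) ^ 3 <= N)%N -> (N <= (L + E) ^ 3)%N ->
  (L ^ 3 <= N + (3 * L ^ 2 * E + 3 * L * E ^ 2 + E ^ 3))%N /\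
  (N <= L ^ 3 + (3 * L ^ 2 * E + 3 * L * E ^ 2 + E ^ 3))%N.
Proof.
move=> h1 h2; split; last by apply: leq_trans h2 _; apply/eqP; rewrite -/(_ == _); lia.
have [le|lt] := leqP E L.
  have [d ed] : exists d, L = (E + d)%N by exists (L - E)%N; rewrite subnKC.
  move: h1; rewrite ed addKn => h1; apply: leq_trans (leq_add h1 (leqnn _)).
  by clear; nia.
apply: leq_trans (leq_addl _ _).
have : (L ^ 3 <= E ^ 3)%N by rewrite leq_exp2r // ltnW.
by move: (L ^ 3)%N (E ^ 3)%N => ? ?; lia.
Qed.

(** Put k = 312 W. The side E = 26 (2 m + 1) of the box of representatives is at most 78 p^(1/3),
    and p^(1/3) <= 4 W L because 49 <= 4^3, so also E <= k L. Then 3 L^2 E + 3 L E^2 + E^3 is at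
    most this constant times L^2 p^(1/3). *)
Definition ev_const (W : nat) : R :=
  78 * (3 + 3 * (312 * W%:R) + (312 * W%:R) ^+ 2).

Lemma ev_const_ge0 (W : nat) : 0 <= ev_const W.
Proof.
apply: mulr_ge0 (ler0n _ _) (addr_ge0 _ (sqr_ge0 _)).
exact: addr_ge0 (ler0n _ _) (mulr_ge0 (ler0n _ _) (mulr_ge0 (ler0n _ _) (ler0n _ _))).
Qed.

(* The equidistribution error is relative to [L^2 / p^(2/3)]: it comes from the
   boundary of the box, the fundamental domain having diameter [O(p^(1/3))]. *)
Lemma ev_sol_approx (p W L : nat) (t r : int) : prime p ->
  (p%:Z %| t ^+ 3 + 2)%Z -> (0 < W)%N -> (0 < L)%N -> (p <= 49 * (W * L) ^ 3)%N ->
  `| #|ev_sol p L t r|%:R - L%:R ^+ 3 / p%:R | <=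
    ev_const W * L%:R ^+ 2 * (cbrt p%:R ^+ 2)^-1 :> R.
Proof.
move=> pp ht W0 L0 pB; rewrite /ev_const; set k := 312 * W%:R; have p0 := prime_gt0 pp.
have [m [hm hm']] := @cbrt_floor 13 p isT p0.
have [E eE] : exists E, E = (26 * (2 * m + 1))%N by eexists.
have [h1 h2] := cube_shift_le (ev_sol_ge L r p0 ht hm hm') (ev_sol_le L r p0 ht hm hm').
set N := #|_| in h1 h2 *; rewrite -eE in h1 h2.
have pR : (0 : R) < p%:R by rewrite ltr0n.
have q3 : cbrt (p%:R : R) ^+ 3 = p%:R by apply: cbrtK; exact: ltW.
have q0 : (0 : R) < cbrt p%:R by exact: cbrt_gt0.
have q1 : (1 : R) <= cbrt p%:R.
  by apply: le_cbrt_of_cube => //; rewrite expr1n ler1n.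
have qm : m%:R <= cbrt p%:R :> R.
  apply: le_cbrt_of_cube => //.
  by rewrite -natrX ler_nat; clear -hm; lia.
have qL : cbrt p%:R <= 4 * W%:R * L%:R :> R.
  apply: cbrt_le_of_cube; [exact: ltW|by rewrite !mulr_ge0|].
  rewrite -!natrM -natrX ler_nat; apply: leq_trans pB _.
  by rewrite -mulnA (expnMn 4) leq_mul2r orbT.
have LR : (0 : R) < L%:R by rewrite ltr0n.
have WR : (0 : R) < W%:R by rewrite ltr0n.
have k0 : 0 <= k by exact: mulr_ge0 (ler0n _ _) (ler0n _ _).
have E0 : (0 : R) <= E%:R by [].
have EE : E%:R = 26 * (2 * m%:R + 1) :> R by rewrite eE natrM natrD natrM.
have Eq : E%:R <= 78 * cbrt p%:R :> R by rewrite EE; lra.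
have EL : E%:R <= k * L%:R :> R by rewrite /k; apply: (le_trans Eq); lra.
move: h1 h2; rewrite -!(ler_nat R) !(natrD, natrX, natrM).
move: (E%:R : R) E0 Eq EL {EE} => e e0 Eq EL h1 h2.
have key : 3 * L%:R ^+ 2 * e + 3 * L%:R * e ^+ 2 + e ^+ 3 <=
    78 * (3 + 3 * k + k ^+ 2) * L%:R ^+ 2 * cbrt p%:R :> R.
  have -> : 3 * L%:R ^+ 2 * e + 3 * L%:R * e ^+ 2 + e ^+ 3 =
    e * (3 * L%:R ^+ 2 + 3 * L%:R * e + e ^+ 2) :> R by ring.
  rewrite (_ : 78 * _ * _ * _ = 78 * cbrt p%:R * (3 * L%:R ^+ 2 + 3 * L%:R * (k * L%:R)
     + (k * L%:R) ^+ 2)); last by ring.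
  apply: ler_pM => //; first by rewrite !addr_ge0 // ?mulr_ge0 ?sqr_ge0 // ltW.
  rewrite lerD //; last by rewrite lerXn2r ?nnegrE // mulr_ge0 // ltW.
  by rewrite lerD2l ler_wpM2l // mulr_ge0 // ltW.
rewrite -(ler_pM2r pR) -[X in _ * X <= _](gtr0_norm pR) -normrM mulrBl mulfVK ?gt_eqF //.
rewrite -[X in _ <= X]mulrA (_ : (_ ^+ 2)^-1 * p%:R = cbrt p%:R); last first.
  by rewrite -{2}q3; move: (cbrt _) q0 => q /lt0r_neq0 qn;
    rewrite (exprSr q 2) mulKf // expf_neq0.
apply: le_trans key; rewrite ler_norml; clear -h1 h2; apply/andP; split; lra.
Qed.
End MertensLemmas.

(** * Mertens' theorem for [t^3 + 2] *)

Section Mertens.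
Context {R : realType}.

Definition mertens (n : nat) : R :=
  \sum_(0 <= p < n.+1 | prime p) #|croots p|%:R * (ln (p%:R : R) / p%:R).

Lemma mertens_le (m n : nat) : (m <= n)%N -> mertens m <= mertens n.
Proof.
move=> mn; rewrite /mertens [leRHS](big_cat_nat (n := m.+1)) //= lerDl sumr_ge0 // => p pp.
by rewrite mulr_ge0 // divr_ge0 // ln_ge0 // ler1n prime_gt0.
Qed.

Lemma mertens_ge0 (n : nat) : 0 <= mertens n.
Proof.
apply: sumr_ge0 => p pp; rewrite mulr_ge0 // divr_ge0 // ln_ge0 // ler1n prime_gt0 //.
Qed.

Section Box.
Variables z L W : nat.
Hypotheses (z3 : (3 <= z)%N) (L0 : (0 < L)%N) (W0 : (0 < W)%N) (zW : (z <= W)%N).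
Hypothesis dvdW : forall p, prime p -> (p <= z)%N -> (p %| W)%N.
Hypothesis coprimeW : forall p, prime p -> (z < p)%N -> coprime W p.

(* Taking the elements congruent to [1] modulo a multiple [W] of the primes up to
   [z] removes these primes from the norms, which makes the contribution of the
   [p ^ 2] dividing a norm [O(1 / z)]; the shift of the first coordinate by [2 W L]
   keeps all the norms of order [(W L) ^ 3]. *)
Let B := (49 * (W * L) ^ 3)%N.
Let boxT : finType := ('I_L * 'I_L * 'I_L)%type.
Let alpha1 (x : boxT) : int := 1 + 2 * (W * L)%N%:Z + W%:Z * x.1.1%:Z.
Let alpha2 (x : boxT) : int := 0 + W%:Z * x.1.2%:Z.
Let alpha3 (x : boxT) : int := 0 + W%:Z * x.2%:Z.
Let Nx (x : boxT) : nat := `|nrm (alpha1 x) (alpha2 x) (alpha3 x)|%N.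
Let ER (p : nat) (x : boxT) : nat := #|evroots p (alpha1 x) (alpha2 x) (alpha3 x)|.

Let Nx_bounds x : (6 * (W * L) ^ 3 <= Nx x <= B)%N.
Proof.
have := box_bounds x W0; rewrite -/(alpha1 x) -/(alpha2 x) -/(alpha3 x) /Nx /B.
by move: (nrm _ _ _) ((W * L) ^ 3)%N; clear; lia.
Qed.

Let WL0 : (0 < (W * L) ^ 3)%N. Proof. by rewrite expn_gt0 muln_gt0 W0 L0. Qed.

Let Nx_gt0 x : (0 < Nx x)%N.
Proof. by have /andP[h _] := Nx_bounds x; apply: leq_trans h; rewrite muln_gt0. Qed.

Let dvd_Nx (d : nat) x : (d%:Z %| nrm (alpha1 x) (alpha2 x) (alpha3 x))%Z = (d %| Nx x)%N.
Proof. by rewrite dvdzE. Qed.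

Let Nx_coprime p x : prime p -> (p <= z)%N -> ~~ (p %| Nx x)%N.
Proof.
move=> pp pz; rewrite -dvd_Nx /alpha1 -addrA.
rewrite (_ : 2 * _ + _ = W%:Z * (2 * L%:Z + x.1.1%:Z)); last by rewrite PoszM; ring.
exact: nrm_coprime (dvdW pp pz).
Qed.

Let ln_prime_ge0 p : prime p -> 0 <= ln (p%:R : R).
Proof. by move=> pp; rewrite ln_ge0 // ler1n prime_gt0. Qed.

Let ln_le_lnB n : (0 < n)%N -> (n <= B)%N -> ln (n%:R : R) <= ln B%:R.
Proof. by move=> n0 nB; rewrite ler_ln ?posrE ?ltr0n ?ler_nat // (leq_trans n0). Qed.

(** Valuation and number of roots agree unless p^2 divides the norm. In that case both terms are
    between 0 and 3 ln B: the power of p in the norm is at most B, and there are at most three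
    roots. *)
Let local_error p x : prime p -> (p <= B)%N ->
  `| (logn p (Nx x))%:R * ln p%:R - (ER p x)%:R * ln p%:R | <=
    (if (z < p)%N then 3 * ln B%:R * (p ^ 2 %| Nx x)%N%:R else 0 : R).
Proof.
move=> pp pB; have lp := ln_prime_ge0 pp.
have [zp|pz] := ltnP z p; last first.
  have pN := Nx_coprime x pp pz.
  by rewrite [ER _ _]card_evroots0 ?dvd_Nx // lognE (negPf pN) !andbF subrr normr0.
have lB : 0 <= ln B%:R :> R by rewrite (le_trans lp) // ln_le_lnB // prime_gt0.
have [pN|npN] := boolP (p %| Nx x)%N; last first.
  rewrite [ER _ _]card_evroots0 ?dvd_Nx // lognE (negPf npN) !andbF subrr normr0.
  by rewrite !mulr_ge0.
have [p2N|np2N] := boolP (p ^ 2 %| Nx x)%N; last first.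
  rewrite [ER _ _]card_evroots1 ?dvd_Nx // (_ : logn p (Nx x) = 1%N).
    by rewrite subrr normr0 mulr0.
  have := np2N; have := pN; rewrite -{1}(expn1 p) !pfactor_dvdn //; clear; lia.
rewrite mulr1.
have e0 : 0 <= (ER p x)%:R * ln p%:R :> R by rewrite mulr_ge0.
have e1 : (ER p x)%:R * ln p%:R <= 3 * ln B%:R :> R.
  by apply: ler_pM => //; [rewrite ler_nat card_evroots_le3|rewrite ln_le_lnB // prime_gt0].
have a0 : 0 <= (logn p (Nx x))%:R * ln p%:R :> R by rewrite mulr_ge0.
have a1 : (logn p (Nx x))%:R * ln p%:R <= ln B%:R :> R.
  rewrite mulr_natl -lnXn ?ltr0n ?prime_gt0 // -natrX ln_le_lnB //.
  have /andP[_] := Nx_bounds x; apply: leq_trans; apply: dvdn_leq => //.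
  by rewrite pfactor_dvdn.
by rewrite ler_norml; apply/andP; split; lra.
Qed.

Let main_ge0 p : 0 <= 364 * L%:R ^+ 3 * (p%:R ^+ 2)^-1 :> R.
Proof.
apply: mulr_ge0; last by rewrite invr_ge0 sqr_ge0.
exact: mulr_ge0 (ler0n _ _) (exprn_ge0 _ (ler0n _ _)).
Qed.

Let const_ge0 : 0 <= 3 * ev_const W * L%:R ^+ 2 :> R.
Proof. exact: mulr_ge0 (mulr_ge0 (ler0n _ _) (ev_const_ge0 _)) (sqr_ge0 _). Qed.

(** Exchanging the sums, each root t contributes the number of box elements in its prime lattice,
    which [ev_sol_approx] estimates. *)
Let sum_ER p : prime p -> (z < p)%N -> (p <= B)%N ->
  `| (\sum_x ER p x)%N%:R - #|croots p|%:R * (L%:R ^+ 3 / p%:R) | <=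
    3 * (ev_const W * L%:R ^+ 2 * (cbrt p%:R ^+ 2)^-1) :> R.
Proof.
move=> pp zp pB.
have [r hr] := dvdz_affine (1 + 2 * (W * L)%N%:Z) (coprimeW pp zp).
have -> : (\sum_x ER p x = \sum_(t in croots p) #|ev_sol p L t%:Z r|)%N.
  rewrite (eq_bigr (fun x : boxT => \sum_(t in croots p)
      ((x \in ev_sol p L t%:Z r) : nat))%N) => [|x _]; last first.
    rewrite /ER -sum1_card (eq_bigl (fun t => (t \in croots p) && (x \in ev_sol p L t%:Z r))).
      by rewrite big_mkcondr; apply: eq_bigr => t _; case: (_ \in _).
    move=> t; rewrite [LHS]inE; congr (_ && _).
    rewrite /ev_sol [RHS]finset.in_set -hr; apply: (congr1 (fun y => (p%:Z %| y)%Z)).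
    by rewrite /ev /alpha1 /alpha2 /alpha3; ring.
  rewrite exchange_big /=; apply: eq_bigr => t _.
  by rewrite -sum1_card [RHS]big_mkcond; apply: eq_bigr => x _; case: (_ \in _).
rewrite natr_sum.
rewrite [X in _ - X](_ : _ = \sum_(t in croots p) (L%:R ^+ 3 / p%:R)); last first.
  by rewrite sumr_const mulr_natl.
rewrite -sumrB; apply: (le_trans (ler_norm_sum _ _ _)).
apply: (@le_trans _ _ (\sum_(t in croots p) ev_const W * L%:R ^+ 2 * (cbrt p%:R ^+ 2)^-1)).
  by apply: ler_sum => t ht; apply: ev_sol_approx => //; rewrite -crootsP.
rewrite sumr_const -[leLHS]mulr_natl ler_wpM2r ?ler_nat ?card_croots_prime //.
by rewrite mulr_ge0 ?invr_ge0 ?sqr_ge0 // mulr_ge0 ?sqr_ge0 // ev_const_ge0.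
Qed.

Let sum_ER0 p : prime p -> (p <= z)%N -> (\sum_x ER p x = 0)%N.
Proof.
move=> pp pz; apply: big1 => x _.
by rewrite [ER _ _]card_evroots0 // dvd_Nx Nx_coprime.
Qed.

(** The packing side s = m + 1 satisfies (L / s)^3 <= 13 L^3 / p^2. With (v + 1)^3 <= 4 (v^3 + 1),
    the 7 subgroups give 28 = 7 4 and 364 = 28 13. For p > 7 (W L)^2 the square p^2 exceeds every
    norm, so the constant term is paid only by smaller primes. *)
Let sum_sqr p : prime p -> (z < p)%N ->
  (\sum_x (p ^ 2 %| Nx x)%N)%N%:R <=
    364 * L%:R ^+ 3 * (p%:R ^+ 2)^-1 + 28 * (p <= 7 * (W * L) ^ 2)%N%:R :> R.
Proof.
move=> pp zp; have p0 := prime_gt0 pp.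
have pR : (0 : R) < p%:R by rewrite ltr0n.
have LR : (0 : R) < L%:R by rewrite ltr0n.
have [pV|Vp] := leqP p (7 * (W * L) ^ 2); last first.
  rewrite big1 => [|x _]; first by rewrite mulr0 addr0 main_ge0.
  apply/eqP; rewrite eqb0; apply/negP => /dvdn_leq; rewrite Nx_gt0 => /(_ isT) h.
  have /andP[_ hB] := Nx_bounds x; have := leq_trans h hB; apply/negP; rewrite -ltnNge.
  apply: (@leq_ltn_trans ((7 * (W * L) ^ 2) ^ 2)); last by rewrite ltn_exp2r.
  by rewrite /B (expnMn 7) -expnM leq_mul2l /= leq_pexp2l // muln_gt0 W0 L0.
have p20 : (0 < p ^ 2)%N by rewrite expn_gt0 p0.
have [m [hm hm']] := @cbrt_floor 13 (p ^ 2) isT p20.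
have p3 : (3 < p)%N by apply: leq_ltn_trans zp.
have := @card_sqr_dvd_nrm p pp W L m.+1 (1 + 2 * (W * L)%N%:Z) 0 0 p3
  (coprimeW pp zp) isT hm.
set S := [set x | _]; have -> : #|S| = (\sum_x (p ^ 2 %| Nx x)%N)%N.
  rewrite -sum1_card big_mkcond; apply: eq_bigr => y _.
  by rewrite finset.in_set dvd_Nx; case: (_ %| _)%N.
rewrite -(ler_nat R) => /le_trans; apply.
have mR : (0 : R) < m.+1%:R by rewrite ltr0n.
have hu : (L %/ m.+1)%:R <= L%:R / m.+1%:R :> R.
  by rewrite ler_pdivlMr // -natrM ler_nat leq_trunc_div.
have hu3 : (L%:R / m.+1%:R) ^+ 3 <= 13 * L%:R ^+ 3 * (p%:R ^+ 2)^-1 :> R.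
  have m3 : (0 : R) < m.+1%:R ^+ 3 by rewrite exprn_gt0.
  have p2 : (0 : R) < p%:R ^+ 2 by rewrite exprn_gt0.
  rewrite expr_div_n ler_pdivrMr // mulrAC ler_pdivlMr // [leRHS]mulrAC mulrC ler_wpM2r ?exprn_ge0 //.
  by rewrite -!natrX -natrM ler_nat.
rewrite mulr1 natrM natrX -(natr1 (L %/ m.+1)); move: hu hu3.
have v0 : (0 : R) <= (L %/ m.+1)%:R by [].
move: ((L %/ m.+1)%:R : R) v0 (L%:R / m.+1%:R) => v v0 u vu u3.
have : (v + 1) ^+ 3 <= 4 * (u ^+ 3 + 1).
  have uv3 : v ^+ 3 <= u ^+ 3 by rewrite lerXn2r ?nnegrE // (le_trans v0).
  suff : 0 <= 4 * (v ^+ 3 + 1) - (v + 1) ^+ 3 by lra.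
  rewrite (_ : _ - _ = 3 * (v + 1) * (v - 1) ^+ 2); last by ring.
  by rewrite mulr_ge0 ?sqr_ge0 // mulr_ge0 // addr_ge0.
rewrite (_ : 364 * _ * _ = 28 * (13 * L%:R ^+ 3 * (p%:R ^+ 2)^-1)); last by ring.
move: ((v + 1) ^+ 3) (u ^+ 3) (13 * _ * _) u3 => a b c; lra.
Qed.
Let T : R := \sum_x ln ((Nx x)%:R : R).

(** The sources of error, in order: norms divisible by p^2 (main part, then constant part),
    equidistribution, and the primes up to z, which occur in [mertens] but divide no norm of the
    box. *)
Let bound (p : nat) : R :=
  (if (z < p)%N then 3 * ln B%:R * (364 * L%:R ^+ 3) * (p%:R ^+ 2)^-1 else 0)
  + (if (0 < p <= 7 * (W * L) ^ 2)%N then 3 * ln B%:R * 28 * 1 else 0)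
  + 3 * ev_const W * L%:R ^+ 2 * (ln p%:R * (cbrt p%:R ^+ 2)^-1)
  + (if (p < z.+1)%N then L%:R ^+ 3 * (#|croots p|%:R * (ln p%:R / p%:R)) else 0).

Let lnB_ge0 : 0 <= ln B%:R :> R.
Proof. by rewrite ln_ge0 // ler1n /B muln_gt0. Qed.

Let prime_term p : prime p -> (p <= B)%N ->
  `| \sum_x (logn p (Nx x))%:R * ln p%:R
     - L%:R ^+ 3 * (#|croots p|%:R * (ln p%:R / p%:R)) | <= bound p.
Proof.
move=> pp pB; have lp := ln_prime_ge0 pp; have p0 := prime_gt0 pp.
have h1 : `| \sum_x ((logn p (Nx x))%:R * ln p%:R - (ER p x)%:R * ln p%:R) | <=
    (if (z < p)%N then 3 * ln B%:R * (\sum_x (p ^ 2 %| Nx x)%N)%N%:R else 0 : R).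
  apply: (le_trans (ler_norm_sum _ _ _)).
  apply: (le_trans (ler_sum _ (fun x _ => local_error x pp pB))).
  by case: ifP => _; [rewrite natr_sum mulr_sumr|rewrite big1].
rewrite sumrB -mulr_suml -mulr_suml -(natr_sum _ _ _ (ER p)) in h1.
rewrite -mulr_suml; set a := (\sum_x _) * _ in h1 *; set e : R := (\sum_x ER p x)%N%:R in h1.
rewrite /bound p0 /=.
have lB28 : 0 <= (if (p <= 7 * (W * L) ^ 2)%N then 3 * ln B%:R * 28 * 1 else 0) :> R.
  by case: ifP => _ //; rewrite !mulr_ge0.
have K0 : 0 <= 3 * ev_const W * L%:R ^+ 2 * (ln p%:R * (cbrt p%:R ^+ 2)^-1) :> R.
  by apply: (mulr_ge0 const_ge0); rewrite mulr_ge0 // invr_ge0 sqr_ge0.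
have [zp|pz] := ltnP z p; last first.
  rewrite (_ : (p < z.+1)%N = true) //.
  move: h1; rewrite ltnNge pz /= /e sum_ER0 // mul0r subr0 normr_le0 => /eqP ->.
  rewrite sub0r normrN ger0_norm; first by rewrite lerDr add0r addr_ge0.
  by rewrite !mulr_ge0 // ?exprn_ge0 // invr_ge0.
rewrite (_ : (p < z.+1)%N = false); last by rewrite ltnS leqNgt zp.
rewrite zp in h1.
have h2 := sum_ER pp zp pB; rewrite -/e in h2.
have h3 := sum_sqr pp zp.
have h1' : `|a - e * ln p%:R| <= 3 * ln B%:R * (364 * L%:R ^+ 3 * (p%:R ^+ 2)^-1
     + 28 * (p <= 7 * (W * L) ^ 2)%N%:R).
  by apply: (le_trans h1); rewrite ler_wpM2l // mulr_ge0.
have h2' : `|e * ln p%:R - L%:R ^+ 3 * (#|croots p|%:R * (ln p%:R / p%:R))| <=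
    3 * ev_const W * L%:R ^+ 2 * (ln p%:R * (cbrt p%:R ^+ 2)^-1).
  rewrite (_ : _ - _ = (e - #|croots p|%:R * (L%:R ^+ 3 / p%:R)) * ln p%:R); last by ring.
  rewrite normrM (ger0_norm lp); apply: (le_trans (ler_wpM2r lp h2)).
  by rewrite le_eqVlt; apply/orP; left; apply/eqP; ring.
have := le_trans (ler_normD _ _) (lerD h1' h2').
rewrite [X in `|X|](_ : _ = a - L%:R ^+ 3 * (#|croots p|%:R * (ln p%:R / p%:R)));
  last by ring.
move/le_trans; apply.
case: (p <= _)%N; move: (ln B%:R) ((p%:R ^+ 2)^-1 : R) => b i.
  by rewrite mulr1n; lra.
by rewrite mulr0n; lra.
Qed.
Let cbrtB_le : cbrt B%:R <= 4 * (W%:R * L%:R) :> R.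
Proof.
apply: cbrt_le_of_cube; [by []|by rewrite !mulr_ge0|].
by rewrite -!natrM -natrX ler_nat /B (expnMn 4) leq_mul2r orbT.
Qed.

Let sum_bound : \sum_(0 <= p < B.+1 | prime p) bound p <=
  3 * ln B%:R * (364 * L%:R ^+ 3) * z%:R^-1
  + 3 * ln B%:R * 28 * (7 * (W * L) ^ 2)%N%:R
  + 3 * ev_const W * L%:R ^+ 2 * (ln 4 * (3 * (4 * (W%:R * L%:R))))
  + L%:R ^+ 3 * mertens z.
Proof.
rewrite /bound !big_split /=; apply: lerD; first apply: lerD; first apply: lerD.
- rewrite -big_mkcondr -mulr_sumr; apply: ler_wpM2l.
    apply: (mulr_ge0 (mulr_ge0 (ler0n _ _) lnB_ge0)).
    exact: mulr_ge0 (ler0n _ _) (exprn_ge0 _ (ler0n _ _)).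
  have := @sum_inv_sqr_le R z B.+1 (leq_trans _ z3); move/(_ isT); apply: le_trans.
  rewrite big_mkcond [leRHS]big_mkcond; apply: ler_sum => p _.
  case: (prime p) => //=; case: ifP => // _; by rewrite invr_ge0 sqr_ge0.
- rewrite -big_mkcondr -mulr_sumr; apply: ler_wpM2l.
    exact: mulr_ge0 (mulr_ge0 (ler0n _ _) lnB_ge0) (ler0n _ _).
  have := sum_le_const (R := R) (7 * (W * L) ^ 2) B.+1; apply: le_trans.
  by rewrite big_mkcond [leRHS]big_mkcond; apply: ler_sum => p _;
    case: (prime p) => //=; case: ifP.
- rewrite -mulr_sumr; apply: (ler_wpM2l const_ge0).
  apply: (le_trans (prime_sum_le (f := fun i => (cbrt i%:R ^+ 2)^-1) B _ _)) => [i|i|].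
  + have c0 : 0 < cbrt i.+1%:R :> R by exact: cbrt_gt0.
    have c1 : cbrt i.+1%:R <= cbrt i.+2%:R :> R by apply: cbrt_le; rewrite ?ler_nat.
    rewrite lef_pV2 ?posrE ?exprn_gt0 ?(lt_le_trans c0 c1) //.
    by rewrite lerXn2r ?nnegrE ?(ltW c0) ?(le_trans (ltW c0) c1).
  + by rewrite invr_ge0 sqr_ge0.
  rewrite ler_wpM2l ?ln_ge0 ?ler1n //; apply: (le_trans (sum_cbrt_le B)).
  by rewrite ler_wpM2l.
rewrite -big_mkcondr /mertens mulr_sumr [leRHS](big_nat_widen _ _ B.+1) //.
rewrite ltnS (leq_trans zW) // /B (leq_trans (leq_pmulr W L0)) //.
apply: leq_trans (leq_pmull _ _) => //.
by rewrite -{1}(expn1 (W * L)) leq_pexp2l // muln_gt0 W0 L0.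
Qed.

(** The two evaluations of T: each norm is between B / 49 and B, so T is L^3 ln B up to L^3 ln 49;
    prime by prime, T is L^3 [mertens B] up to the sum of [bound]. Here 1092 = 3 364, 588 = 3 28 7,
    36 = 3 3 4, and 52 comes from the crude bound ln B <= 52 W L. *)
Lemma mertens_box_aux : `| mertens B - ln B%:R | <= 1092 / z%:R * ln B%:R
  + (ln 49 + 588 * 52 * W%:R ^+ 3 + 36 * ev_const W * ln 4 * W%:R + mertens z).
Proof.
have LR : (0 : R) < L%:R by rewrite ltr0n.
have WR : (0 : R) < W%:R by rewrite ltr0n.
have L3 : (0 : R) < L%:R ^+ 3 by rewrite exprn_gt0.
have BR : (0 : R) < B%:R by rewrite ltr0n muln_gt0.
have cardT : #|boxT| = (L ^ 3)%N by rewrite !card_prod !card_ord mulnn -expnSr.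
have hT : `| T - L%:R ^+ 3 * ln B%:R | <= L%:R ^+ 3 * ln 49.
  have -> : L%:R ^+ 3 * ln B%:R = \sum_(x : boxT) ln B%:R :> R.
    by rewrite sumr_const -natrX -cardT mulr_natl.
  have -> : L%:R ^+ 3 * ln 49 = \sum_(x : boxT) ln 49 :> R.
    by rewrite sumr_const -natrX -cardT mulr_natl.
  rewrite /T -sumrB; apply: (le_trans (ler_norm_sum _ _ _)); apply: ler_sum => x _.
  have /andP[l u] := Nx_bounds x.
  have l1 := ln_le_lnB (Nx_gt0 x) u.
  have l2 : ln B%:R <= ln 49 + ln (Nx x)%:R :> R.
    have N49 : (0 < 49 * Nx x)%N by rewrite muln_gt0 Nx_gt0.
    rewrite -lnM ?posrE ?ltr0n // -natrM ler_ln ?posrE //; last by rewrite ltr0n.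
    by rewrite ler_nat /B leq_mul2l; apply: leq_trans l; rewrite leq_pmull.
  by rewrite ler0_norm; lra.
have eT : T = \sum_(0 <= p < B.+1 | prime p) \sum_x (logn p (Nx x))%:R * ln p%:R.
  rewrite exchange_big /=; apply: eq_bigr => x _; have /andP[_ u] := Nx_bounds x.
  exact: ln_nat_decomp.
have hM : `| T - L%:R ^+ 3 * mertens B | <= \sum_(0 <= p < B.+1 | prime p) bound p.
  rewrite eT /mertens mulr_sumr -sumrB; apply: (le_trans (ler_norm_sum _ _ _)).
  rewrite big_nat_cond [leRHS]big_nat_cond; apply: ler_sum => p /andP[/andP[_ pB] pp].
  exact: prime_term.
have lnBle : ln B%:R <= 52 * (W%:R * L%:R) :> R.
  rewrite /B natrM natrX lnM ?posrE ?ltr0n // ?exprn_gt0 ?ltr0n ?muln_gt0 ?W0 //.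
  rewrite lnXn ?ltr0n ?muln_gt0 ?W0 // natrM.
  have WL1 : 1 <= W%:R * L%:R :> R by rewrite -natrM ler1n muln_gt0 W0.
  have := @ln_le_sub1 R 49 (ltr0Sn _ _); have := @ln_le_sub1 R (W%:R * L%:R) (lt_le_trans ltr01 WL1).
  by rewrite -mulr_natl; move: WL1; lra.
have hS := sum_bound.
rewrite -(ler_pM2l L3) -{1}(gtr0_norm L3) -normrM mulrBr.
have : `|L%:R ^+ 3 * mertens B - L%:R ^+ 3 * ln B%:R| <= L%:R ^+ 3 * ln 49
    + \sum_(0 <= p < B.+1 | prime p) bound p.
  by apply: (le_trans _ (lerD hT hM)); rewrite -[X in _ <= _ + X]normrN opprB addrC;
   apply: (le_trans _ (ler_normD _ _)); rewrite le_eqVlt; apply/orP; left; apply/eqP;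
   congr (`| _ |); ring.
move/le_trans; apply; apply: (le_trans (lerD (lexx _) hS)).
have : 3 * ln B%:R * 28 * (7 * (W * L) ^ 2)%N%:R <= 588 * 52 * W%:R ^+ 3 * L%:R ^+ 3 :> R.
  rewrite natrM natrX natrM.
  rewrite (_ : _ * _ = 588 * (W%:R * L%:R) ^+ 2 * ln B%:R); last by ring.
  rewrite (_ : 588 * 52 * _ * _ = 588 * (W%:R * L%:R) ^+ 2 * (52 * (W%:R * L%:R))); last by ring.
  exact: (ler_wpM2l (mulr_ge0 (ler0n _ _) (sqr_ge0 _))).
move: (ln B%:R) (ln 49) (ln 4) (mertens z) (ev_const W) (z%:R^-1 : R) => b l4 l5 mz ev zi.
move: (3 * b * 28 * _) => X hX; rewrite -subr_ge0.
rewrite (_ : _ - _ = 588 * 52 * W%:R ^+ 3 * L%:R ^+ 3 - X) ?subr_ge0 //; ring.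
Qed.
End Box.

Lemma mertens_box (z : nat) : (3 <= z)%N -> exists K : R, 0 <= K /\
  forall L : nat, (0 < L)%N ->
    `| mertens (49 * (z`! * L) ^ 3) - ln (49 * (z`! * L) ^ 3)%N%:R | <=
    1092 / z%:R * ln (49 * (z`! * L) ^ 3)%N%:R + K.
Proof.
(* K is read off from [mertens_box_aux], where only ln B depends on L; W = z! has exactly the primes
   up to z as prime factors. *)
move=> z3; eexists; split; last first.
  move=> L L0; apply: mertens_box_aux => //; first exact: fact_gt0.
  - by apply: dvdn_leq (fact_gt0 z) _; rewrite dvdn_fact // leqnn andbT; lia.
  - by move=> p pp pz; rewrite dvdn_fact // prime_gt0.
  move=> p pp; rewrite coprime_sym prime_coprime //; elim: z {z3} => [|n IH] h.
    by rewrite fact0 dvdn1; case: eqP pp => // ->.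
  rewrite factS Euclid_dvdM // negb_or IH ?andbT; last by lia.
  by apply/negP => /dvdn_leq; lia.
have l1 n : 0 <= ln n.+1%:R :> R by rewrite ln_ge0 // ler1n.
apply: addr_ge0; [apply: addr_ge0; [apply: addr_ge0|]|].
- exact: l1.
- exact: mulr_ge0 (mulr_ge0 (ler0n _ _) (ler0n _ _)) (exprn_ge0 _ (ler0n _ _)).
- apply: mulr_ge0 (ler0n _ _); apply: mulr_ge0; last exact: l1.
  exact: mulr_ge0 (ler0n _ _) (ev_const_ge0 _).
exact: mertens_ge0.
Qed.

(** The boxes only reach the values c L^3. Consecutive ones have ratio at most 8 and [mertens] is
    monotone, so interpolation costs a multiple of ln 8; z is taken with 1092 / z <= e. *)
Lemma mertens_asymp (e : R) : 0 < e -> exists K : R, 0 <= K /\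
  forall n : nat, (0 < n)%N -> `| mertens n - ln n%:R | <= e * ln n%:R + K.
Proof.
move=> e0.
have [z [z3 ze]] : exists z : nat, (3 <= z)%N /\ 1092 / z%:R <= e.
  exists (maxn 3 (Num.truncn (1092 / e)).+1); split; first exact: leq_maxl.
  set z := maxn _ _; have zp : (0 : R) < z%:R by rewrite ltr0n; apply: leq_trans (leq_maxl _ _).
  rewrite ler_pdivrMr // mulrC -ler_pdivrMr //.
  apply: (le_trans (ltW (truncnS_gt _))); rewrite ler_nat; exact: leq_maxr.
have [K [K0 hK]] := mertens_box z3.
have [c [c0 cE]] : exists c, (0 < c)%N /\ forall L, (49 * (z`! * L) ^ 3 = c * L ^ 3)%N.
  exists (49 * z`! ^ 3)%N; split; first by rewrite muln_gt0 expn_gt0 fact_gt0.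
  by move=> L; rewrite expnMn mulnA.
have M0 := mertens_ge0 c.
have lc0 : 0 <= ln c%:R :> R by rewrite ln_ge0 // ler1n.
have l80 : 0 <= ln 8 :> R by rewrite ln_ge0 // ler1n.
exists (mertens c + ln c%:R + K + ln 8 * (1 + e)); split.
  by rewrite !addr_ge0 // mulr_ge0 // addr_ge0 // ltW.
move=> n n0; have ln0 : 0 <= ln n%:R :> R by rewrite ln_ge0 // ler1n.
have lmono (a b : nat) : (0 < a)%N -> (a <= b)%N -> ln a%:R <= ln b%:R :> R.
  by move=> a0 ab; rewrite ler_ln ?posrE ?ltr0n ?ler_nat // (leq_trans a0).
have le8 : 0 <= ln 8 * e by rewrite mulr_ge0 // ltW.
have eln : 0 <= e * ln n%:R by rewrite mulr_ge0 // ltW.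
have [nc|cn] := ltnP n c.
  have h1 := mertens_le (ltnW nc); have h2 := lmono _ _ n0 (ltnW nc).
  have h3 := mertens_ge0 n.
  by rewrite ler_norml; apply/andP; split; lra.
have [m [hm hm']] := cbrt_floor c0 (ltn0Sn n).
case: m hm hm' => [|m] hm hm'; first by move: hm'; rewrite exp1n muln1 ltnNge cn.
have u1 : (0 < c * m.+1 ^ 3)%N by rewrite muln_gt0 c0 expn_gt0.
have u2 : (0 < c * m.+2 ^ 3)%N by rewrite muln_gt0 c0 expn_gt0.
have mM1 := mertens_le (hm : (c * m.+1 ^ 3 <= n)%N).
have mM2 := mertens_le (ltnW hm').
have lM1 := lmono _ _ u1 (hm : (c * m.+1 ^ 3 <= n)%N).
have lM2 := lmono _ _ n0 (ltnW hm').
have l12 : ln (c * m.+2 ^ 3)%N%:R <= ln 8 + ln (c * m.+1 ^ 3)%N%:R :> R.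
  rewrite -lnM ?posrE ?ltr0n // -natrM; apply: lmono => //.
  rewrite mulnCA leq_mul2l; apply/orP; right.
  by rewrite -[8%N]/(2 ^ 3)%N -expnMn leq_exp2r // mul2n -addnn addSn ltnS leq_addl.
have := hK m.+1 isT; have := hK m.+2 isT; rewrite !cE.
have w1 : 1092 / z%:R * ln (c * m.+1 ^ 3)%N%:R <= e * ln (c * m.+1 ^ 3)%N%:R :> R.
  by rewrite ler_wpM2r // ln_ge0 // ler1n.
have w2 : 1092 / z%:R * ln (c * m.+2 ^ 3)%N%:R <= e * ln (c * m.+2 ^ 3)%N%:R :> R.
  by rewrite ler_wpM2r // ln_ge0 // ler1n.
have v1 : e * ln (c * m.+1 ^ 3)%N%:R <= e * ln n%:R by rewrite ler_wpM2l // ltW.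
have v2 : e * ln (c * m.+2 ^ 3)%N%:R <= e * (ln 8 + ln n%:R).
  by apply: (ler_wpM2l (ltW e0)); apply: (le_trans l12); rewrite lerD2l.
rewrite !ler_norml => /andP[a1 a2] /andP[a3 a4].
move: w1 w2 v1 v2 a1 a2 a3 a4 mM1 mM2 lM1 lM2 l12 le8.
move: (1092 / z%:R : R) (ln (c * m.+1 ^ 3)%:R) (ln (c * m.+2 ^ 3)%:R).
by move=> x1 x2 x3 *; apply/andP; split; lra.
Qed.
End Mertens.

(** * Partial summation: the sum of rho(p) / p *)

Section PrimeRecipSum.
Context {R : realType}.
Implicit Types x y z : R.

Definition prsum (y z : R) : R :=
  \sum_(0 <= p < (Num.truncn z).+1 | prime p && (y <= p%:R)) #|croots p|%:R / p%:R.

Lemma prsum_ge0 y z : 0 <= prsum y z.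
Proof. by apply: sumr_ge0 => p _; rewrite divr_ge0. Qed.

Lemma prsum_split y z w : z <= w -> prsum y w <= prsum y z + prsum z w.
Proof.
move=> zw; rewrite /prsum.
rewrite [X in _ <= X + _](big_nat_widen _ _ (Num.truncn w).+1); last by rewrite ltnS le_truncn.
rewrite big_mkcond [X in _ <= X + _]big_mkcond [X in _ <= _ + X]big_mkcond -big_split /=; apply: ler_sum => p _.
have t0 : 0 <= #|croots p|%:R / p%:R :> R by rewrite divr_ge0.
case: (prime p) => /=; last by rewrite addr0.
case: (leP y p%:R) => yp /=; last by rewrite add0r; case: ifP.
case: (ltnP p (Num.truncn z).+1) => pz; first by rewrite lerDl; case: ifP.
have -> : z <= p%:R by rewrite (le_trans (ltW (truncnS_gt z))) // ler_nat.
by rewrite add0r.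
Qed.

Lemma mertens_interval (e : R) : 0 < e -> exists K : R, 0 <= K /\
  forall y z, 2 <= y -> y <= z ->
    \sum_(0 <= p < (Num.truncn z).+1 | prime p && (y <= p%:R))
       #|croots p|%:R * (ln (p%:R : R) / p%:R) <= ln z - ln y + e * ln z + K.
Proof.
move=> e0; have e20 : 0 < e / 2 by rewrite divr_gt0.
have [K [K0 hK]] := mertens_asymp e20.
have l4 : 0 <= ln 4 :> R by rewrite ln_ge0 // ler1n.
exists (2 * K + ln 4); split; first by rewrite addr_ge0 // mulr_ge0.
move=> y z y2 yz.
have y0 : 0 < y by apply: lt_le_trans y2. have z0 : 0 < z by apply: lt_le_trans yz.
pose m := Num.truncn y; pose n := Num.truncn z.
have m2 : (2 <= m)%N by rewrite truncn_ge_nat // ltW.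
have mn : (m <= n)%N by exact: le_truncn.
have n0 : (0 < n)%N by apply: leq_trans mn; apply: leq_trans m2.
have m1 : (0 < m.-1)%N by case: m m2 {mn} => [|[]].
have nz : n%:R <= z by rewrite truncn_le // ltW.
have ym : y <= 4 * m.-1%:R.
  apply: (le_trans (ltW (truncnS_gt y))); rewrite -natrM ler_nat -/m.
  by move: m2; clear; lia.
(* The sum subtracted stops at m - 1, since y may itself be the prime m; the shift costs only ln 4,
   by y <= 4 (m - 1). *)
have M : \sum_(0 <= p < n.+1 | prime p && (y <= p%:R))
    #|croots p|%:R * (ln (p%:R : R) / p%:R) <= mertens n - mertens m.-1.
  rewrite lerBrDr /mertens.
  rewrite [X in _ + X](big_nat_widen _ _ n.+1); last by rewrite ltnS (leq_trans (leq_pred _)).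
  rewrite big_mkcond [X in _ + X <= _]big_mkcond [leRHS]big_mkcond -big_split /=; apply: ler_sum => p _.
  case: ifP => [/andP[pp yp]|_]; last first.
    rewrite add0r; case: ifP => [/andP[pp _]|_]; first by rewrite pp.
    by case: ifP => // pp; rewrite mulr_ge0 // divr_ge0 // ln_ge0 // ler1n prime_gt0.
  rewrite pp /= ifF ?addr0 //; apply/negP; rewrite ltnS => pm.
  have : (p < m)%N by apply: leq_ltn_trans pm _; rewrite prednK // (leq_trans _ m2).
  rewrite -(ltr_nat R) => lpm; have my : m%:R <= y by rewrite truncn_le // ltW.
  by have := lt_le_trans lpm my; rewrite ltNge yp.
have := hK n n0; have := hK m.-1 m1.
have ln1 : ln n%:R <= ln z by rewrite ler_ln ?posrE // ltr0n.
have ln2 : ln m.-1%:R <= ln z.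
  apply: le_trans ln1; rewrite ler_ln ?posrE ?ltr0n // ler_nat.
  by apply: leq_trans mn; exact: leq_pred.
have ln3 : ln y <= ln 4 + ln m.-1%:R.
  by rewrite -lnM ?posrE ?ltr0n // ler_ln ?posrE // mulr_gt0 // ltr0n.
have u1 : e / 2 * ln n%:R <= e / 2 * ln z by rewrite ler_wpM2l // ltW.
have u2 : e / 2 * ln m.-1%:R <= e / 2 * ln z by rewrite ler_wpM2l // ltW.
rewrite !ler_norml => /andP[a1 a2] /andP[a3 a4].
apply: (le_trans M).
move: (mertens n) (mertens m.-1) (ln n%:R) (ln m.-1%:R) (ln 4) a1 a2 a3 a4 u1 u2 ln1 ln2 ln3.
by move=> x1 x2 x3 x4 x5 *; lra.
Qed.

(** Each ln p is at least a ln X here. The resulting b / a - 1 is sharp to first order for ln (b /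
    a), hence only useful when b / a is close to 1. *)
Lemma prsum_interval (e : R) : 0 < e -> exists K : R, 0 <= K /\
  forall X a b : R, 1 < X -> 0 < a -> a <= b -> 2 <= X `^ a ->
    prsum (X `^ a) (X `^ b) <= (b / a - 1) + e * (b / a) + K / (a * ln X).
Proof.
move=> e0; have [K [K0 hK]] := mertens_interval e0; exists K; split=> // X a b X1 a0 ab X2.
have X0 : 0 < X by lra.
have lX : 0 < ln X by rewrite ln_gt0.
have alX : 0 < a * ln X by rewrite mulr_gt0.
have := hK (X `^ a) (X `^ b) X2 (ler_powR (ltW X1) ab).
rewrite !ln_powR => h.
rewrite (_ : _ + _ = (b * ln X - a * ln X + e * (b * ln X) + K) / (a * ln X)); last first.
  by field; rewrite !gt_eqF.
rewrite ler_pdivlMr //; apply: le_trans h; rewrite /prsum mulr_suml.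
apply: ler_sum => p /andP[pp hp].
rewrite -mulrA ler_wpM2l // [p%:R^-1 * _]mulrC ler_wpM2r ?invr_ge0 //.
by rewrite -ln_powR ler_ln // posrE ?powR_gt0 // ltr0n prime_gt0.
Qed.

Lemma expR_le_quad (x : R) : 0 <= x -> x <= 2^-1 -> expR x <= 1 + x + 2 * x ^+ 2.
Proof.
move=> x0 x1; have h := expR_ge1Dx (- x).
have i0 : 0 < 1 - x by lra.
have : expR x * (1 - x) <= 1.
  by rewrite -[leRHS](expRxMexpNx_1 x) ler_wpM2l // expR_ge0.
rewrite -ler_pdivlMr // => /le_trans; apply; rewrite ler_pdivrMr //.
rewrite -subr_ge0 (_ : _ - 1 = x ^+ 2 * (1 - 2 * x)); last by ring.
by rewrite mulr_ge0 ?sqr_ge0 //; lra.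
Qed.

(* The sum is cut at the points [X^(d r^i)] of a geometric progression, on each
   piece of which [ln p] is constant up to a factor [r]. *)
Lemma prsum_asymp (d g eta : R) : 0 < d -> d <= g -> 0 < eta ->
  exists X0 : R, forall X, X0 <= X -> prsum (X `^ d) (X `^ g) <= ln (g / d) + eta.
Proof.
move=> d0 dg eta0; set l := ln (g / d).
have gd1 : 1 <= g / d by rewrite ler_pdivlMr // mul1r.
have l0 : 0 <= l by rewrite ln_ge0.
(* The number of pieces: 2 l makes the step x = l / n at most 1 / 2, and 6 l^2 / eta makes the
   quadratic error 2 l^2 / n at most eta / 3. *)
pose n := (Num.truncn (2 * l + 6 * l ^+ 2 / eta)).+1.
have n0 : (0 : R) < n%:R by rewrite ltr0n.
have q0 : 0 <= 6 * l ^+ 2 / eta by apply: divr_ge0 (ltW eta0); exact: mulr_ge0 (ler0n _ _) (sqr_ge0 _).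
have nb : 2 * l + 6 * l ^+ 2 / eta < n%:R by exact: truncnS_gt.
pose x := l / n%:R; pose r := expR x.
have x0 : 0 <= x by rewrite divr_ge0 // ltW.
have x1 : x <= 2^-1 by rewrite ler_pdivrMr //; lra.
have rq := expR_le_quad x0 x1; rewrite -/r in rq.
have r1 : 1 <= r by rewrite /r; apply: le_trans (expR_ge1Dx x); lra.
have r2 : r <= 2 by nra.
have nx : n%:R * x = l by rewrite /x mulrC mulfVK // gt_eqF.
have nr : n%:R * (r - 1) <= l + eta / 3.
  have : n%:R * (r - 1) <= n%:R * (x + 2 * x ^+ 2) by apply: (ler_wpM2l (ltW n0)); lra.
  move/le_trans; apply; rewrite mulrDr nx lerD2l.
  rewrite (_ : n%:R * _ = 2 * l * x); last by rewrite -nx; ring.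
  rewrite /x mulrA ler_pdivrMr //.
  have : 6 * l ^+ 2 / eta <= n%:R by lra.
  by rewrite ler_pdivrMr //; lra.
have e0 : 0 < eta / (6 * n%:R) by rewrite divr_gt0 // mulr_gt0.
have [K [K0 hK]] := prsum_interval e0.
(* For ln X >= T, the second term gives X^d >= 2, and the third bounds the n errors K / (d ln X) by
   eta / 3 in total. *)
pose T := 1 + ln 2 / d + 3 * n%:R * K / (d * eta).
have t1 : 0 <= ln 2 / d by apply: divr_ge0 (ltW d0); rewrite ln_ge0 // ler1n.
have t2 : 0 <= 3 * n%:R * K / (d * eta).
  apply: divr_ge0; last by rewrite ltW // mulr_gt0.
  exact: mulr_ge0 (mulr_ge0 (ler0n _ _) (ler0n _ _)) K0.
have T1 : 1 <= T by rewrite /T; lra.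
exists (expR T) => X XT.
have X0 : 0 < X by apply: lt_le_trans XT; exact: expR_gt0.
have lX : T <= ln X by rewrite -[T]expRK ler_ln ?posrE ?expR_gt0.
have X1 : 1 < X.
  by apply: lt_le_trans XT; rewrite expR_gt1; lra.
have lX0 : 0 < ln X by lra.
have Xd : 2 <= X `^ d.
  rewrite -ler_ln ?posrE ?powR_gt0 // ln_powR mulrC -ler_pdivrMr //.
  by apply: le_trans lX; rewrite /T; lra.
have step i : prsum (X `^ (d * r ^+ i)) (X `^ (d * r ^+ i.+1)) <=
    (r - 1) + eta / (6 * n%:R) * r + K / (d * ln X).
  have ri : 1 <= r ^+ i by rewrite exprn_ege1.
  have dri : d <= d * r ^+ i by rewrite ler_peMr // ltW.
  have dri0 : 0 < d * r ^+ i by apply: lt_le_trans dri.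
  have := hK X (d * r ^+ i) (d * r ^+ i.+1) X1 dri0.
  rewrite exprS mulrCA ler_peMl ?(ltW dri0) // => /(_ isT).
  have -> : 2 <= X `^ (d * r ^+ i).
    by apply: le_trans Xd _; apply: ler_powR => //; exact: ltW.
  move=> /(_ isT); rewrite mulfK ?gt_eqF // => /le_trans; apply.
  rewrite lerD2l; apply: (ler_wpM2l K0); rewrite lef_pV2 ?posrE ?(mulr_gt0 dri0) ?(mulr_gt0 d0) //.
  exact: (ler_wpM2r (ltW lX0)).
set c := (r - 1) + _ + _ in step.
have sums k : prsum (X `^ d) (X `^ (d * r ^+ k.+1)) <= k.+1%:R * c.
  elim: k => [|k IH].
    by have := step 0; rewrite expr0 mulr1 mul1r.
  apply: (le_trans (@prsum_split _ (X `^ (d * r ^+ k.+1)) _ _)).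
    apply: ler_powR; first exact: ltW.
    rewrite ler_wpM2l ?(ltW d0) // [leRHS]exprS ler_peMl // exprn_ge0 //; lra.
  by rewrite -natr1 mulrDl mul1r; apply: lerD.
have := sums n.-1; rewrite prednK //.
have -> : d * r ^+ n = g.
  rewrite /r -expRM_natl nx /l lnK ?posrE ?divr_gt0 //; last exact: lt_le_trans dg.
  by rewrite mulrC divfK // gt_eqF.
move/le_trans; apply; rewrite /c !mulrDr.
have b1 : n%:R * (eta / (6 * n%:R) * r) <= eta / 3.
  rewrite (_ : n%:R * _ = eta / 6 * r); last by field; rewrite gt_eqF.
  have : eta / 6 * r <= eta / 6 * 2 by rewrite ler_wpM2l // divr_ge0 // ltW.
  by lra.
have b2 : n%:R * (K / (d * ln X)) <= eta / 3.
  rewrite mulrA ler_pdivrMr ?mulr_gt0 //.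
  have : T * (d * eta) <= ln X * (d * eta) by rewrite ler_wpM2r // mulr_ge0 // ltW.
  have : 3 * n%:R * K <= T * (d * eta).
    by rewrite -ler_pdivrMr ?mulr_gt0 // /T lerDr addr_ge0.
  by lra.
by lra.
Qed.
End PrimeRecipSum.

(** * Counting [n] with many large prime factors *)

Section SmallPrimes.
Context {R : realType}.

Lemma Omega_ge_seq (X delta : R) (m h : nat) : (0 < m)%N ->
  (h <= Omega_ge X delta m)%N ->
  exists s : seq nat, [/\ sorted leq s, (h <= size s)%N,
    all (fun p => prime p && (X `^ delta <= p%:R)) s
    & (\prod_(p <- s) p %| m)%N].
Proof.
move=> m0 hh; pose P (p : nat) := X `^ delta <= p%:R.
pose s0 := flatten [seq nseq (logn p m) p | p <- primes m & P p].
have ps : perm_eq (sort leq s0) s0 by rewrite perm_sort.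
exists (sort leq s0); split.
- by apply: sort_sorted; exact: leq_total.
- rewrite size_sort size_flatten /shape -map_comp sumnE big_map big_filter.
  by under eq_bigr do rewrite /= size_nseq.
- rewrite (perm_all _ ps); apply/allP => p /flattenP[t /mapP[q qm ->]] /nseqP[-> _].
  move: qm; rewrite mem_filter mem_primes => /andP[Pq /andP[qp _]].
  by rewrite qp.
rewrite (perm_big _ ps) /= big_flatten big_map big_filter.
under eq_bigr do rewrite big_nseq iter_muln_1.
rewrite [X in (_ %| X)%N](prod_prime_decomp m0) prime_decompE big_map [X in (_ %| X)%N](bigID P) /=.
exact: dvdn_mulr.
Qed.

Lemma leq_prod_exp (x : nat) (s : seq nat) : (forall p, p \in s -> (p <= x)%N) ->
  (\prod_(p <- s) p <= x ^ size s)%N.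
Proof.
elim: s => [|a s IH] h; first by rewrite big_nil.
rewrite big_cons expnS leq_mul ?h ?inE ?eqxx // IH // => p ps.
by rewrite h // inE ps orbT.
Qed.

Lemma leq_exp_prod (x : nat) (s : seq nat) : (forall p, p \in s -> (x <= p)%N) ->
  (x ^ size s <= \prod_(p <- s) p)%N.
Proof.
elim: s => [|a s IH] h; first by rewrite big_nil.
rewrite big_cons expnS leq_mul ?h ?inE ?eqxx // IH // => p ps.
by rewrite h // inE ps orbT.
Qed.

Lemma nuniq_sqr_dvd (s : seq nat) : ~~ uniq s ->
  exists2 q, q \in s & (q ^ 2 %| \prod_(p <- s) p)%N.
Proof.
elim: s => //= a s IH; rewrite negb_and negbK big_cons => /orP[as_|/IH[q qs hq]].
  exists a; first by rewrite inE eqxx.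
  by rewrite expnS expn1 dvdn_mul // (big_rem a) //= dvdn_mulr.
by exists q; rewrite ?inE ?qs ?orbT // dvdn_mull.
Qed.

(* [rcons u x] holds the [k] smallest of at least [h >= 3 k] prime factors. *)
Lemma smallest_primes (s : seq nat) (k h m : nat) : sorted leq s -> all prime s ->
  (0 < k)%N -> (3 * k <= h)%N -> (h <= size s)%N -> (\prod_(p <- s) p <= m)%N ->
  exists u x, [/\ {subset rcons u x <= s}, size u = k.-1, (forall p, p \in u -> (p <= x)%N),
    ((\prod_(p <- rcons u x) p) ^ 3 <= m)%N
    & ((\prod_(p <- u) p) * x ^ (h - k.-1) <= m)%N /\ (\prod_(p <- rcons u x) p %| \prod_(p <- s) p)%N].
Proof.
move=> ss ps k0 kh hs sm.
have ks : (k <= size s)%N by apply: leq_trans hs; lia.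
have sE : s = take k s ++ drop k s by rewrite cat_take_drop.
have := size_takel ks; case: (lastP (take k s)) sE => [|u x] sE su.
  by move: k0; rewrite -su.
rewrite size_rcons in su; exists u, x; set v := drop k s in sE.
have szv : (h - k <= size v)%N by rewrite size_drop leq_sub2r.
have /and3P[/allrelP uv ux _] :
    [&& allrel leq (rcons u x) v, pairwise leq (rcons u x) & pairwise leq v].
  by rewrite -pairwise_cat -sE -(sorted_pairwise leq_trans).
move: ux; rewrite pairwise_rcons => /andP[/allP ux _].
have x0 : (0 < x)%N.
  by apply: prime_gt0; move/allP: ps; apply; rewrite sE mem_cat mem_rcons inE eqxx.
(* The remaining primes are at least x. As h - k >= 2 k, their product is at least x^(2 k), hence at
   least the square of the product of the k smallest; this gives the cube bound. *)
have vx : (x ^ (h - k) <= \prod_(p <- v) p)%N.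
  apply: (@leq_trans (x ^ size v)); first by rewrite leq_pexp2l.
  by apply: leq_exp_prod => p pv; apply: uv => //; rewrite mem_rcons inE eqxx.
have sub : {subset rcons u x <= s} by move=> p pu; rewrite sE mem_cat pu.
have ux' p : p \in rcons u x -> (p <= x)%N.
  by rewrite mem_rcons inE => /orP[/eqP->|/ux].
have uxk : (\prod_(p <- rcons u x) p <= x ^ k)%N.
  by apply: leq_trans (leq_prod_exp ux') _; rewrite size_rcons su.
have {}sm : (\prod_(p <- rcons u x) p * \prod_(p <- v) p <= m)%N by rewrite -big_cat -sE.
split; [exact: sub|by rewrite -su|exact: ux| |]; last first.
- split; last by rewrite {1}sE big_cat /= dvdn_mulr.
  apply: leq_trans sm; rewrite big_rcons /= -mulnA leq_mul2l; apply/orP; right.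
  rewrite (_ : (h - k.-1 = (h - k).+1)%N); last by lia.
  by rewrite expnS leq_mul2l vx orbT.
- apply: leq_trans sm; rewrite expnS leq_mul2l; apply/orP; right; apply: leq_trans vx.
  apply: (@leq_trans ((x ^ k) ^ 2)); first by rewrite leq_exp2r.
  by rewrite -expnM leq_pexp2l //; lia.
Qed.
End SmallPrimes.

(** * Residue classes among the integers of (X, 2X] *)

Section ResidueCounting.
Context {R : realType}.
Implicit Types X : R.

Lemma card_dvd_diff_le (N d : nat) X (S : {set 'I_N}) : (0 < d)%N -> 0 <= X ->
  (forall a b, a \in S -> b \in S -> (a <= b)%N ->
     (d %| b - a)%N /\ b%:R - a%:R <= X) ->
  #|S|%:R <= X / d%:R + 1.
Proof.
move=> d0 X0 h; have dR : (0 : R) < d%:R by rewrite ltr0n.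
have Xd : 0 <= X / d%:R by rewrite divr_ge0.
have [->|/set0Pn[a1 a1S]] := eqVneq S finset.set0; first by rewrite cards0 addr_ge0.
pose a0 := [arg min_(a < a1 in S) (a : nat)].
have [a0S a0min] : a0 \in S /\ forall b, b \in S -> (a0 <= b)%N.
  by rewrite /a0; case: arg_minnP.
pose T := Num.truncn (X / d%:R).
pose f (a : 'I_N) : 'I_T.+1 := inord ((a - a0) %/ d).
have fE a : a \in S -> f a = ((a - a0) %/ d)%N :> nat.
  move=> aS; rewrite inordK // ltnS truncn_ge_nat // ler_pdivlMr // -natrM.
  have [dv le] := h _ _ a0S aS (a0min _ aS).
  by rewrite divnK // natrB // a0min.
have inj : {in S &, injective f}.
  move=> a b aS bS /(congr1 val) /=; rewrite !fE // => e.
  have [dva _] := h _ _ a0S aS (a0min _ aS); have [dvb _] := h _ _ a0S bS (a0min _ bS).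
  have : (a - a0 = b - a0)%N by rewrite -(divnK dva) -(divnK dvb) e.
  by move=> e'; apply/val_inj => /=; rewrite -(subnKC (a0min _ aS)) e' subnKC // a0min.
rewrite -(card_in_imset inj).
have : (#|f @: S| <= T.+1)%N by rewrite (leq_trans (max_card _)) // card_ord.
rewrite -(ler_nat R) => /le_trans; apply; rewrite -natr1 lerD2r.
by rewrite truncn_le.
Qed.

Definition dyadic X : {set 'I_(Num.truncn (2 * X)).+1} :=
  [set n : 'I_(Num.truncn (2 * X)).+1 | X < n%:R <= 2 * X].

Lemma card_dyadic_residues X (d : nat) (S : {set 'I_(Num.truncn (2 * X)).+1}) :
  0 <= X -> (0 < d)%N -> S \subset dyadic X ->
  (forall a b, a \in S -> b \in S -> a = b %[mod d]) -> #|S|%:R <= X / d%:R + 1.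
Proof.
move=> X0 d0 /fintype.subsetP sub hS; apply: card_dvd_diff_le => // a b aS bS ab.
split; first by rewrite -eqn_mod_dvd //; apply/eqP; rewrite (hS a b).
have := sub _ aS; have := sub _ bS; rewrite !finset.in_set => /andP[? ?] /andP[? ?]; lra.
Qed.

Lemma card_sqr_dvd_cubic X (q : nat) : 0 <= X -> prime q -> (3 < q)%N ->
  #|[set n in dyadic X | (q ^ 2 %| n ^ 3 + 2)%N]|%:R <= 3 * (X / q%:R ^+ 2 + 1).
Proof.
move=> X0 qp q3; have q0 := prime_gt0 qp; have q20 : (0 < q ^ 2)%N by rewrite expn_gt0 q0.
set S := [set n in _ | _].
pose F (t : 'I_(q ^ 2)) := [set n in dyadic X | (n %% q ^ 2 == t)%N].
have sub : S \subset \bigcup_(t in croots (q ^ 2)) F t.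
  apply/fintype.subsetP => n; rewrite finset.in_set => /andP[nd hn].
  have lt : (n %% q ^ 2 < q ^ 2)%N by rewrite ltn_pmod.
  apply/finset.bigcupP; exists (Ordinal lt); last by rewrite finset.in_set nd /=.
  by rewrite finset.in_set /=; move: hn; rewrite /dvdn -modnDml -modnXm modnDml.
have := leq_trans (subset_leq_card sub) (card_bigcup_sum _ _).
rewrite -(ler_nat R) natr_sum => /le_trans; apply.
have c0 : 0 <= X / q%:R ^+ 2 + 1 by rewrite addr_ge0 // divr_ge0 // exprn_ge0.
apply: (@le_trans _ _ (\sum_(t in croots (q ^ 2)) (X / q%:R ^+ 2 + 1))).
  apply: ler_sum => t _; rewrite -natrX; apply: card_dyadic_residues => //.
    by apply/fintype.subsetP => n; rewrite finset.in_set => /andP[].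
  by move=> a b; rewrite !finset.in_set => /andP[_ /eqP ->] /andP[_ /eqP ->].
rewrite sumr_const -[leLHS]mulr_natl ler_wpM2r // ler_nat.
exact: card_croots_sqr.
Qed.

Lemma prod_uniq_primes_dvd (s : seq nat) (n : nat) : uniq s -> all prime s ->
  (forall p, p \in s -> (p %| n)%N) -> (\prod_(p <- s) p %| n)%N.
Proof.
elim: s => [|a s IH] /=; first by rewrite big_nil dvd1n.
move=> /andP[as_ us] /andP[pa ps] h; rewrite big_cons Gauss_dvd.
  by rewrite h ?inE ?eqxx //= IH // => p ip; rewrite h // inE ip orbT.
rewrite prime_coprime // big_seq; elim/big_rec: _ => [|i x iS hx].
  by rewrite dvdn1; case: eqP pa => // ->.
rewrite Euclid_dvdM // negb_or hx andbT dvdn_prime2 //; last exact: (allP ps).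
by apply: contraNneq as_ => ->.
Qed.

(** The n are sorted by their residues modulo the [P i], a tuple of roots. The primes being
    distinct, two n with the same tuple are congruent modulo the product. *)
Lemma card_dyadic_multi X (k M : nat) (P : {ffun 'I_k -> 'I_M}) : 0 <= X ->
  (forall i, prime (P i)) -> injective P ->
  #|[set n in dyadic X | [forall i, (P i %| n ^ 3 + 2)%N]]|%:R <=
    (\prod_i #|croots (P i)|)%N%:R * (X / (\prod_i P i)%N%:R + 1).
Proof.
move=> X0 pp Pinj; set S := [set n in _ | _].
have P0 i : (0 < P i)%N by exact: prime_gt0.
have D0 : (0 < \prod_i P i)%N by exact: prodn_gt0.
(* The roots are transported from ['I_(P i)], a type depending on i, to the common type ['I_M], so
   that [card_family] applies. *)
pose G (i : 'I_k) := [pred t : 'I_M | (t < P i)%N && (P i %| t ^ 3 + 2)%N].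
have cG i : #|G i| = #|croots (P i)|.
  have inj : injective (widen_ord (ltnW (ltn_ord (P i)))).
    by move=> a b /(congr1 val) /= e; exact: val_inj.
  rewrite -(card_imset _ inj) -[RHS]cardsE; apply: eq_card => t; rewrite [RHS]inE.
  apply/idP/imsetP => [/andP[lt dv]|[u]].
    by exists (Ordinal lt); [rewrite inE|apply/val_inj].
  by rewrite inE => dv ->; rewrite inE /= ltn_ord.
pose F (t : {ffun 'I_k -> 'I_M}) := [set n in dyadic X | [forall i, (n %% P i == t i)%N]].
pose A := [set t : {ffun 'I_k -> 'I_M} | t \in family G].
have cA : #|A| = (\prod_i #|croots (P i)|)%N.
  rewrite cardsE card_family foldrE big_map big_enum /=.
  by apply: eq_bigr => i _; rewrite cG.
have sub : S \subset \bigcup_(t in A) F t.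
  apply/fintype.subsetP => n; rewrite finset.in_set => /andP[nd /forallP hn].
  have lt i : (n %% P i < M)%N by apply: ltn_trans (ltn_ord (P i)); rewrite ltn_pmod.
  apply/finset.bigcupP; exists [ffun i => Ordinal (lt i)].
    rewrite finset.in_set; apply/familyP => i; rewrite ffunE inE /= ltn_pmod //=.
    by have := hn i; rewrite /dvdn -modnDml -modnXm modnDml.
  by rewrite finset.in_set nd; apply/forallP => i; rewrite ffunE.
have := leq_trans (subset_leq_card sub) (card_bigcup_sum _ _).
rewrite -(ler_nat R) natr_sum => /le_trans; apply.
apply: (@le_trans _ _ (\sum_(t in A) (X / (\prod_i P i)%N%:R + 1))); last first.
  by rewrite sumr_const cA -[leLHS]mulr_natl.
apply: ler_sum => t _; apply: card_dyadic_residues => //.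
  by apply/fintype.subsetP => n; rewrite finset.in_set => /andP[].
move=> a b; rewrite !finset.in_set => /andP[_ /forallP ha] /andP[_ /forallP hb].
wlog ab : a b ha hb / (b <= a)%N.
  by move=> H; have [l|l] := leqP b a; [exact: H|symmetry; apply: H => //; exact: ltnW].
apply/eqP; rewrite eqn_mod_dvd //.
rewrite -(big_map (fun i => P i : nat) xpredT id); apply: prod_uniq_primes_dvd.
- by rewrite map_inj_uniq ?index_enum_uniq // => i j /val_inj /Pinj.
- by apply/allP => _ /mapP[i _ ->].
- by move=> _ /mapP[i _ ->]; rewrite -eqn_mod_dvd // (eqP (ha i)) (eqP (hb i)).
Qed.
End ResidueCounting.

(** * Tuples of large primes with bounded product *)

Section PrimeTuples.
Context {R : realType}.

Lemma sum_ord_le (M n : nat) (c c' : pred nat) (F : nat -> R) :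
  (forall p, c p -> (p < n)%N /\ c' p) -> (forall p, c' p -> 0 <= F p) ->
  \sum_(p < M | c p) F p <= \sum_(0 <= p < n | c' p) F p.
Proof.
move=> h F0; rewrite -(big_mkord c F).
rewrite [leLHS](big_nat_widen _ _ (maxn M n)) ?leq_maxl //.
rewrite [leRHS](big_nat_widen _ _ (maxn M n)) ?leq_maxr //.
rewrite big_mkcond [leRHS]big_mkcond; apply: ler_sum => p _.
case: ifP => [/andP[cp _]|_].
  by have [pn c'p] := h p cp; rewrite c'p pn.
by case: ifP => // /andP[c'p _]; apply: F0.
Qed.

Lemma sum_ffun_prod_le (M k : nat) (S : pred {ffun 'I_k -> 'I_M}) (F : nat -> R)
    (c : pred nat) :
  (forall P, S P -> forall i, c (P i)) -> (forall p, c p -> 0 <= F p) ->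
  \sum_(P | S P) \prod_i F (P i) <= (\sum_(p < M | c p) F p) ^+ k.
Proof.
move=> h F0; pose G (p : nat) := if c p then F p else 0.
have G0 p : 0 <= G p by rewrite /G; case: ifP => // /F0.
have -> : (\sum_(p < M | c p) F p) ^+ k = \prod_(i < k) \sum_(p < M) G p.
  by rewrite prodr_const card_ord big_mkcond.
rewrite bigA_distr_bigA big_mkcond; apply: ler_sum => P _.
case: ifP => SP; last by apply: prodr_ge0.
by rewrite le_eqVlt; apply/orP; left; apply/eqP; apply: eq_bigr => i _; rewrite /G h.
Qed.

Definition large_primes (k M : nat) (y Z : R) (P : {ffun 'I_k -> 'I_M}) : bool :=
  [forall i, prime (P i) && (y <= (P i)%:R)] && ((\prod_i P i)%N%:R <= Z).

Lemma large_primesP (k M : nat) (y Z : R) (P : {ffun 'I_k -> 'I_M}) :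
  large_primes y Z P -> forall i, [/\ prime (P i), y <= (P i)%:R & (P i)%:R <= Z].
Proof.
move=> /andP[/forallP h hZ] i; have /andP[pi yi] := h i; split=> //.
apply: le_trans hZ; rewrite ler_nat (bigD1 i) //= leq_pmulr // prodn_gt0 // => j.
by have /andP[pj _] := h j; exact: prime_gt0.
Qed.

Lemma sum_inv_primes_le (M : nat) (y Z : R) : 1 < y -> 1 <= Z ->
  \sum_(p < M | prime p && (y <= p%:R <= Z)) (p%:R : R)^-1 <= ln 4 * (1 + ln Z) / ln y.
Proof.
move=> y1 Z1; have ly : 0 < ln y by rewrite ln_gt0.
have y0 : 0 < y by lra. have Z0 : 0 < Z by lra.
have n0 : (0 < Num.truncn Z)%N by rewrite truncn_ge_nat // ltW.
rewrite ler_pdivlMr // mulr_suml.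
apply: (@le_trans _ _ (\sum_(p < M | prime p && (y <= p%:R <= Z)) ln (p%:R : R) * p%:R^-1)).
  apply: ler_sum => p /andP[pp /andP[yp _]]; rewrite mulrC ler_wpM2r ?invr_ge0 //.
  by rewrite ler_ln ?posrE // ltr0n prime_gt0.
apply: (@le_trans _ _ (\sum_(0 <= p < (Num.truncn Z).+1 | prime p) ln (p%:R : R) * p%:R^-1)).
  apply: (@sum_ord_le _ _ (fun p => prime p && (y <= p%:R <= Z)) prime
    (fun p => ln (p%:R : R) * p%:R^-1)) => p.
    by move=> /andP[pp /andP[_ pZ]]; split=> //; rewrite ltnS truncn_ge_nat // ltW.
  by move=> pp; rewrite mulr_ge0 ?invr_ge0 // ln_ge0 // ler1n prime_gt0.
apply: (le_trans (prime_sum_le (f := fun i => i%:R^-1) _ _ _)) => [i|i|].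
- by rewrite lef_pV2 ?posrE ?ltr0n // ler_nat.
- by rewrite invr_ge0.
rewrite ler_wpM2l ?ln_ge0 ?ler1n //; apply: (le_trans (harmonic_le n0)).
by rewrite lerD2l ler_ln ?posrE ?ltr0n // truncn_le // ltW.
Qed.

(** Given the other primes, the first one is at most Z divided by their product, and [theta_le]
    counts it with weight ln p >= ln y. The k others contribute sums of 1 / p, bounded when y is a
    fixed power of X and Z = 3 X; so one ln X is saved. *)
Lemma card_large_primes (k M : nat) (y Z : R) : 1 < y -> 1 <= Z ->
  #|[pred P : {ffun 'I_k.+1 -> 'I_M} | large_primes y Z P]|%:R * ln y <=
    ln 4 * Z * (ln 4 * (1 + ln Z) / ln y) ^+ k.
Proof.
move=> y1 Z1; have ly : 0 < ln y by rewrite ln_gt0.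
have y0 : 0 < y by lra. have Z0 : 0 < Z by lra.
pose phi (P : {ffun 'I_k.+1 -> 'I_M}) : {ffun 'I_k -> 'I_M} * 'I_M :=
  ([ffun i => P (lift ord0 i)], P ord0).
have phi_inj : injective phi.
  move=> P Q [e1 e2]; apply/ffunP => i; case: (unliftP ord0 i) => [j ->|->] //.
  by have := congr1 (fun f : {ffun 'I_k -> 'I_M} => f j) e1; rewrite !ffunE.
pose B (Q : {ffun 'I_k -> 'I_M}) := [forall i, prime (Q i) && (y <= (Q i)%:R <= Z)].
pose c (Q : {ffun 'I_k -> 'I_M}) (p : nat) :=
  prime p && (y <= p%:R <= Z / (\prod_i Q i)%N%:R).
pose U := [set u : {ffun 'I_k -> 'I_M} * 'I_M | B u.1 && c u.1 u.2].
have B0 Q : B Q -> (0 : R) < (\prod_i Q i)%N%:R.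
  by move=> /forallP BQ; rewrite ltr0n prodn_gt0 // => i; have /andP[/prime_gt0] := BQ i.
have leU : (#|[pred P : {ffun 'I_k.+1 -> 'I_M} | large_primes y Z P]| <= #|U|)%N.
  rewrite -(card_imset _ phi_inj); apply/subset_leq_card/fintype.subsetP => u /imsetP[P].
  rewrite inE => hP ->; have h := large_primesP hP.
  have BP : B (phi P).1.
    by apply/forallP => i; rewrite ffunE; have [-> -> ->] := h (lift ord0 i).
  rewrite finset.in_set BP /=; have [p0 yp _] := h ord0; rewrite /c p0 yp /=.
  rewrite ler_pdivlMr ?B0 // -natrM; case/andP: hP => _; rewrite big_ord_recl.
  by under [in X in _ -> X]eq_bigr do rewrite ffunE.
have eU : #|U|%:R = \sum_(Q | B Q) \sum_(p < M | c Q p) 1 :> R.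
  rewrite pair_big_dep /= -sum1_card natr_sum; apply: eq_bigl => u.
  by rewrite finset.in_set.
rewrite -(ler_nat R) eU in leU; apply: (le_trans (ler_wpM2r (ltW ly) leU)).
rewrite mulr_suml.
apply: (@le_trans _ _ (\sum_(Q | B Q) ln 4 * Z * \prod_i ((Q i)%:R : R)^-1)).
  apply: ler_sum => Q BQ; have D0 := B0 Q BQ.
  rewrite prodfV -natr_prod mulr_suml -mulrA.
  have ZD : 0 <= Z / (\prod_i Q i)%N%:R by rewrite divr_ge0 // ltW.
  apply: (@le_trans _ _ (\sum_(p < M | c Q p) ln (p%:R : R))).
    apply: ler_sum => p /andP[pp /andP[yp _]].
    by rewrite mul1r ler_ln ?posrE // ltr0n prime_gt0.
  apply: (@le_trans _ _ (\sum_(0 <= p < (Num.truncn (Z / (\prod_i Q i)%N%:R)).+1 | prime p)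
      ln (p%:R : R))).
    apply: (@sum_ord_le _ _ (c Q) prime (fun p => ln (p%:R : R))) => p.
      by move=> /andP[pp /andP[_ pZ]]; split=> //; rewrite ltnS truncn_ge_nat.
    by move=> pp; rewrite ln_ge0 // ler1n prime_gt0.
  apply: (le_trans (theta_le _)); rewrite ler_wpM2l ?ln_ge0 ?ler1n //.
  by rewrite truncn_le.
rewrite -mulr_sumr ler_wpM2l //; first by rewrite mulr_ge0 ?ln_ge0 ?ler1n // ltW.
pose d (p : nat) := prime p && (y <= p%:R <= Z).
apply: (@le_trans _ _ ((\sum_(p < M | d p) (p%:R : R)^-1) ^+ k)).
  apply: (@sum_ffun_prod_le M k B (fun p => p%:R^-1) d) => [Q /forallP BQ i|p _].
    exact: BQ.
  by rewrite invr_ge0.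
rewrite lerXn2r ?nnegrE ?sum_inv_primes_le //; first by apply: sumr_ge0.
by rewrite divr_ge0 ?(ltW ly) // mulr_ge0 ?ln_ge0 ?ler1n // addr_ge0 // ln_ge0.
Qed.

Lemma sum_croots_prod_le (k M : nat) (y w Z : R) : 0 <= w ->
  \sum_(P : {ffun 'I_k -> 'I_M} | large_primes y Z P && [forall i, (P i)%:R <= w])
     \prod_i (#|croots (P i)|%:R / (P i)%:R) <= prsum y w ^+ k.
Proof.
move=> w0; pose d (p : nat) := [&& prime p, y <= p%:R & p%:R <= w].
apply: (@le_trans _ _ ((\sum_(p < M | d p) (#|croots p|%:R / p%:R : R)) ^+ k)).
  apply: (@sum_ffun_prod_le M k _ (fun p => #|croots p|%:R / p%:R) d) => [P|p _].
    move=> /andP[hP /forallP hw] i.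
    by have [pi yi _] := large_primesP hP i; rewrite /d pi yi hw.
  by rewrite divr_ge0.
rewrite lerXn2r ?nnegrE ?prsum_ge0 //; first by apply: sumr_ge0 => p _; rewrite divr_ge0.
apply: (@sum_ord_le _ _ d (fun p => prime p && (y <= p%:R)) (fun p => #|croots p|%:R / p%:R)) => p.
  by move=> /and3P[pp yp pw]; rewrite ltnS truncn_ge_nat // pp.
by move=> _; rewrite divr_ge0.
Qed.

(* Each [n] in [S] is counted by the [k!] orderings of its primes. *)
Lemma card_tuples_le (k M : nat) (X y w : R) (S : {set 'I_(Num.truncn (2 * X)).+1}) :
  0 <= X -> 0 <= w -> S \subset dyadic X ->
  (forall n, n \in S -> exists P : {ffun 'I_k -> 'I_M}, [/\ injective P,
     large_primes y (3 * X) P, (forall i, (P i)%:R <= w)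
     & (forall i, P i %| n ^ 3 + 2)%N]) ->
  k`!%:R * #|S|%:R <= X * prsum y w ^+ k
     + 3 ^+ k * #|[pred P : {ffun 'I_k -> 'I_M} | large_primes y (3 * X) P]|%:R.
Proof.
move=> X0 w0 /fintype.subsetP sub hS.
pose Q (P : {ffun 'I_k -> 'I_M}) :=
  large_primes y (3 * X) P && [forall i, (P i)%:R <= w].
pose dv (P : {ffun 'I_k -> 'I_M}) (n : nat) := [forall i, (P i %| n ^ 3 + 2)%N].
pose A := [pred P : {ffun 'I_k -> 'I_M} | injectiveb P && Q P].
have count : (k`! * #|S| <= \sum_(P in A) #|[set n in dyadic X | dv P n]|)%N.
  apply: (@leq_trans (\sum_(P in A) \sum_(n in S) dv P n)%N); last first.
    apply: leq_sum => P _; rewrite -sum1_card big_mkcond [leqRHS]big_mkcond.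
    apply: leq_sum => n _; rewrite finset.in_set.
    by case: ifP => // nS; rewrite sub //=; case: (dv P n).
  rewrite exchange_big /= mulnC -sum_nat_const; apply: leq_sum => n nS.
  have [P [Pinj lP wP dP]] := hS n nS.
  pose F (s : {ffun 'I_k -> 'I_k}) : {ffun 'I_k -> 'I_M} := [ffun i => P (s i)].
  have Finj : injective F.
    move=> s t /ffunP e; apply/ffunP => i; apply: Pinj.
    by have := e i; rewrite !ffunE.
  have <- : #|F @: [set s : {ffun 'I_k -> 'I_k} | injectiveb s]| = k`!.
    by rewrite (card_imset _ Finj) card_inj_ffuns card_ord ffactnn.
  rewrite -sum1_card big_mkcond [leqRHS]big_mkcond.
  apply: leq_sum => T _; case: imsetP => // -[s]; rewrite finset.in_set => /injectiveP sinj ->.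
  have -> : F s \in A.
    rewrite inE; apply/and3P; split.
    - by apply/injectiveP => i j; rewrite !ffunE => /Pinj /sinj.
    - case/andP: lP => /forallP h1 h2; apply/andP; split.
        by apply/forallP => i; rewrite ffunE.
      rewrite (_ : \prod_i F s i = \prod_i P i)%N //.
      by rewrite [RHS](reindex_inj sinj); apply: eq_bigr => i _; rewrite ffunE.
    - by apply/forallP => i; rewrite ffunE.
  by rewrite /dv; case: forallP => // -[] i; rewrite ffunE.
rewrite -natrM; move: count; rewrite -(ler_nat R) => /le_trans; apply.
rewrite natr_sum.
have hA P : P \in A -> (forall i, prime (P i)) /\ injective P.
  rewrite inE => /and3P[/injectiveP Pi lP _]; split=> // i.
  by have [] := large_primesP lP i.
(* The rounding error is at most 1 for each tuple of roots, and there are at most 3^k of these for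
   each tuple of primes. *)
apply: (@le_trans _ _ (\sum_(P in A) (X * \prod_i (#|croots (P i)|%:R / (P i)%:R) + 3 ^+ k))).
  apply: ler_sum => P PA; have [pP iP] := hA P PA.
  apply: (le_trans (card_dyadic_multi X0 pP iP)).
  rewrite mulrDr mulr1; apply: lerD.
    by rewrite mulrCA ler_wpM2l // big_split /= prodfV -!natr_prod.
  rewrite -natrX ler_nat; apply: (@leq_trans (\prod_(i < k) 3)).
    by apply: leq_prod => i _; exact: card_croots_prime.
  by rewrite prod_nat_const card_ord.
rewrite big_split /=; apply: lerD.
  rewrite -mulr_sumr ler_wpM2l //.
  apply: le_trans (sum_croots_prod_le k M y (3 * X) w0).
  rewrite big_mkcond [leRHS]big_mkcond; apply: ler_sum => P _; rewrite inE.
  case: (injectiveb P) => //=; case: ifP => // _.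
  by apply: prodr_ge0 => i _; rewrite divr_ge0.
rewrite sumr_const -[leLHS]mulr_natr ler_wpM2l ?exprn_ge0 // ler_nat.
apply/subset_leq_card/fintype.subsetP => P; rewrite !inE => /and3P[_ + _].
by [].
Qed.
End PrimeTuples.

Lemma ln_expn {R : realType} (x : R) (n : nat) : 0 < x -> ln (x ^+ n) = n%:R * ln x.
Proof. by move=> x0; rewrite lnXn // mulr_natl. Qed.

(** * Attaching tuples of primes to the counted n *)

Section TCount.
Context {R : realType}.
Variables (delta : R) (h : nat).
Hypotheses (delta_gt0 : 0 < delta) (h_ge3 : (3 <= h)%N).
Let k := (h %/ 3)%N.

Definition many_large_primes (X : R) : {set 'I_(Num.truncn (2 * X)).+1} :=
  [set n in dyadic X | (h <= Omega_ge X delta (n ^ 3 + 2))%N].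

Lemma Tcount_le_card (X : R) : 0 < X -> (Tcount X delta h <= #|many_large_primes X|)%N.
Proof.
move=> X0; rewrite cardE -(size_map (fun n : 'I_(Num.truncn (2 * X)).+1 => Posz n)).
apply: uniq_leq_size; first exact: fset_uniq.
move=> z; rewrite in_fset_set; last exact: finite_Tset.
rewrite inE => -[/andP[Xz z2] hz].
case: z Xz z2 hz => [n|n] Xn n2 hn; last first.
  have : (0 : R) < (Negz n)%:~R by apply: lt_trans Xn.
  by rewrite ltr0z.
have nN : (n < (Num.truncn (2 * X)).+1)%N.
  by rewrite ltnS truncn_ge_nat // mulr_ge0 // ltW.
apply/mapP; exists (Ordinal nN) => //.
rewrite mem_enum finset.in_set; apply/andP; split; first by rewrite finset.in_set Xn.
by move: hn; congr (_ <= Omega_ge _ _ _)%N.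
Qed.

Let k_gt0 : (0 < k)%N. Proof. by rewrite divn_gt0. Qed.
Let kh : (3 * k <= h)%N. Proof. by rewrite mulnC leq_trunc_div. Qed.
Let hk : (k <= h)%N. Proof. by apply: leq_trans kh; rewrite leq_pmull. Qed.

Lemma cubic_le (X : R) (n : 'I_(Num.truncn (2 * X)).+1) : 1 <= X -> n \in dyadic X ->
  (n ^ 3 + 2)%N%:R <= 10 * X ^+ 3.
Proof.
move=> X1; rewrite finset.in_set => /andP[_ n2]; rewrite natrD natrX.
have : n%:R ^+ 3 <= (2 * X) ^+ 3 by rewrite lerXn2r ?nnegrE //; lra.
have : 1 <= X ^+ 3 by rewrite exprn_ege1.
by rewrite exprMn -[2 ^+ 3]natrX; lra.
Qed.

(** A product of h primes at least X^delta would exceed 10 X^3, hence n^3 + 2. *)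
Lemma many_large_primes_eq0 (X : R) : 1 <= X -> ln 10 < (h%:R * delta - 3) * ln X ->
  #|many_large_primes X| = 0%N.
Proof.
move=> X1 hX; apply: eq_card0 => n; apply/negP; rewrite finset.in_set => /andP[nd].
move=> /Omega_ge_seq; rewrite addn2 => /(_ isT)[s [_ hs /allP ps /(dvdn_leq (ltn0Sn _)) sm]].
have X0 : 0 < X by lra.
have y1 : 1 <= X `^ delta by rewrite -(powRr0 X); apply: ler_powR => //; exact: ltW.
have key (t : seq nat) : {subset t <= s} ->
    (X `^ delta) ^+ size t <= (\prod_(p <- t) p)%N%:R.
  elim: t => [|a t IH] sub; first by rewrite big_nil.
  rewrite big_cons exprS natrM; apply: ler_pM.
  - by lra.
  - by rewrite exprn_ge0 //; lra.
  - by have /andP[] := ps a (sub a (mem_head _ _)).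
  - by apply: IH => b bt; apply: sub; rewrite inE bt orbT.
have h1 : (X `^ delta) ^+ h <= 10 * X ^+ 3.
  apply: le_trans (cubic_le X1 nd); rewrite addn2.
  apply: (@le_trans _ _ (\prod_(p <- s) p)%N%:R); last by rewrite ler_nat.
  by apply: le_trans (key s _) => //; apply: ler_weXn2l.
have : ln ((X `^ delta) ^+ h) <= ln (10 * X ^+ 3).
  by rewrite ler_ln ?posrE ?exprn_gt0 ?mulr_gt0 ?powR_gt0 ?exprn_gt0.
rewrite lnM ?posrE ?exprn_gt0 ?ltr0n // !ln_expn ?powR_gt0 // ln_powR.
by move=> h2; lra.
Qed.

(** Catches the n whose k smallest primes are not distinct. A repeated q has q^2 <= 3 X, as the
    product of the k primes is at most 3 X; this leaves O(X^(1/2)) values of q, so the rounding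
    errors of the classes modulo q^2 are negligible. *)
Definition sqr_bad (X : R) (n : nat) : bool :=
  [exists q : 'I_(Num.truncn (3 * X)).+1,
     [&& prime q, X `^ delta <= q%:R, (q ^ 2)%N%:R <= 3 * X & (q ^ 2 %| n ^ 3 + 2)%N]].

Lemma card_sqr_bad (X : R) : 0 < X -> 4 <= X `^ delta ->
  #|[set n in dyadic X | sqr_bad X n]|%:R <= 6 * X / X `^ delta + 3 * (3 * X) `^ 2^-1.
Proof.
move=> X0; set y := X `^ delta => y4; have y0 : 0 < y by lra.
pose c (q : nat) := [&& prime q, y <= q%:R & (q ^ 2)%N%:R <= 3 * X].
pose A := [set q : 'I_(Num.truncn (3 * X)).+1 | c q].
pose F (q : 'I_(Num.truncn (3 * X)).+1) := [set n in dyadic X | (q ^ 2 %| n ^ 3 + 2)%N].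
have sub : [set n in dyadic X | sqr_bad X n] \subset \bigcup_(q in A) F q.
  apply/fintype.subsetP => n; rewrite finset.in_set => /andP[nd /existsP[q /and4P[q1 q2 q3 q4]]].
  apply/finset.bigcupP; exists q; first by rewrite finset.in_set /c q1 q2 q3.
  by rewrite finset.in_set nd q4.
have := leq_trans (subset_leq_card sub) (card_bigcup_sum _ _).
rewrite -(ler_nat R) natr_sum => /le_trans; apply.
(* Any q >= y is strictly above z, as [sum_inv_sqr_le] requires, while y >= 4 gives y <= 2 z. *)
pose z := (Num.truncn y).-1.
have t4 : (4 <= Num.truncn y)%N by rewrite truncn_ge_nat // ltW.
have z0 : (0 < z)%N by rewrite /z; case: (Num.truncn y) t4 => [|[]].
have zR : (0 : R) < z%:R by rewrite ltr0n.
have yz : y <= 2 * z%:R.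
  apply: (le_trans (ltW (truncnS_gt y))); rewrite -natrM ler_nat /z.
  by move: t4; move: (Num.truncn y); clear; lia.
have cz q : c q -> (z < q)%N.
  move=> /and3P[_ yq _]; rewrite /z; case: (Num.truncn y) t4 (truncn_le y) => // t _.
  by rewrite (ltW y0) => /le_trans/(_ yq); rewrite ler_nat.
pose V := Num.truncn ((3 * X) `^ 2^-1).
have cV q : c q -> (0 < q <= V)%N.
  move=> cq; rewrite (leq_ltn_trans _ (cz q cq)) //=; case/and3P: cq => _ _ q2.
  rewrite truncn_ge_nat ?powR_ge0 //.
  have -> : q%:R = ((q%:R : R) ^+ 2) `^ 2^-1.
    by rewrite -powR_mulrn // -powRrM mulfV ?powRr1.
  by apply: ge0_ler_powR; rewrite ?nnegrE ?exprn_ge0 ?mulr_ge0 ?(ltW X0) // -natrX.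
apply: (@le_trans _ _ (\sum_(q in A) (3 * X * (q%:R ^+ 2)^-1 + 3 * 1))).
  apply: ler_sum => q; rewrite finset.in_set => cq.
  rewrite -[3 * X * _]mulrA -mulrDr; apply: card_sqr_dvd_cubic; first exact: ltW.
    by case/and3P: cq.
  by apply: leq_ltn_trans (cz q cq); rewrite /z; case: (Num.truncn y) t4.
rewrite big_split /= -!mulr_sumr; apply: lerD.
  apply: (@le_trans _ _ (3 * X * z%:R^-1)).
    apply: ler_wpM2l; first by rewrite mulr_ge0 // ltW.
    apply: le_trans (sum_inv_sqr_le (Num.truncn (3 * X)).+1 z0).
    rewrite (eq_bigl (fun q : 'I__ => c q)) => [|q]; last by rewrite finset.in_set.
    apply: (@sum_ord_le _ _ _ c (fun q => (z < q)%N) (fun q => (q%:R ^+ 2)^-1)) => q.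
      move=> cq; split; last exact: cz.
      case/and3P: cq => /prime_gt0 q0 _ q2; rewrite ltnS truncn_ge_nat ?mulr_ge0 ?(ltW X0) //.
      by apply: le_trans q2; rewrite ler_nat -{1}(expn1 q) leq_pexp2l.
    by rewrite invr_ge0 sqr_ge0.
  rewrite (_ : 6 * X / y = 3 * X * (2 / y)); last by ring.
  apply: ler_wpM2l; first by rewrite mulr_ge0 // ltW.
  by rewrite ler_pdivlMr // mulrC ler_pdivrMr.
apply: ler_wpM2l => //.
apply: (@le_trans _ _ V%:R); last by rewrite truncn_le // powR_ge0.
apply: le_trans (sum_le_const V V.+1).
rewrite (eq_bigl (fun q : 'I__ => c q)) => [|q]; last by rewrite finset.in_set.
apply: (@sum_ord_le _ _ _ c (fun q => (0 < q <= V)%N) (fun=> 1)) => // q cq.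
by split; [have /andP[_] := cV q cq|exact: cV].
Qed.

(** Here gamma exceeds beta, and the logarithmic hypothesis says that the gap absorbs the factor 10
    in n^3 + 2 <= 10 X^3. *)
Lemma good_tuple (X gamma : R) (n : 'I_(Num.truncn (2 * X)).+1) : 1 < X ->
  ln 10 <= (gamma * (h%:R - k%:R + 1) - (3 - (k%:R - 1) * delta)) * ln X ->
  n \in many_large_primes X -> ~~ sqr_bad X n ->
  exists P : {ffun 'I_k -> 'I_(Num.truncn (3 * X)).+1}, [/\ injective P,
     large_primes (X `^ delta) (3 * X) P, (forall i, (P i)%:R <= X `^ gamma)
     & (forall i, P i %| n ^ 3 + 2)%N].
Proof.
move=> X1 hX; rewrite finset.in_set => /andP[nd].
have m0 : (0 < n ^ 3 + 2)%N by rewrite addn2.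
move=> /(Omega_ge_seq m0)[s [ss hs /allP ps sm]] nbad.
have psp : all prime s by apply/allP => p /ps/andP[].
have [u [x [sub su ux cube [low vs]]]] :=
  smallest_primes ss psp k_gt0 kh hs (dvdn_leq m0 sm).
set v := rcons u x in sub cube vs.
have szv : size v = k by rewrite size_rcons su prednK.
have mX := cubic_le (ltW X1) nd.
have X0 : 0 < X by lra.
have y0 : 0 < X `^ delta by rewrite powR_gt0.
have pv p : p \in v -> prime p by move/sub/ps/andP => [].
have yv p : p \in v -> X `^ delta <= p%:R by move/sub/ps/andP => [].
(* The cube is at most 10 X^3, and 10 <= 27. *)
have v3 : (\prod_(p <- v) p)%N%:R <= 3 * X.
  have : (\prod_(p <- v) p)%N%:R ^+ 3 <= (3 * X) ^+ 3.
    rewrite -natrX; apply: (@le_trans _ _ (n ^ 3 + 2)%N%:R); first by rewrite ler_nat.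
    apply: (le_trans mX); rewrite exprMn -natrX ler_wpM2r ?exprn_ge0 ?ler_nat //.
    exact: ltW.
  by rewrite ler_pXn2r ?nnegrE ?mulr_ge0 ?(ltW X0).
have v0 : (0 < \prod_(p <- v) p)%N.
  by rewrite big_seq prodn_cond_gt0 // => p /pv; exact: prime_gt0.
have le_prod p : p \in v -> (p <= \prod_(q <- v) q)%N.
  by move=> pin; apply: dvdn_leq => //; rewrite (big_rem p) //= dvdn_mulr.
have ltM p : p \in v -> (p < (Num.truncn (3 * X)).+1)%N.
  move=> pin; rewrite ltnS truncn_ge_nat ?mulr_ge0 ?(ltW X0) //.
  by apply: le_trans v3; rewrite ler_nat le_prod.
have uv : uniq v.
  apply: contraT => /nuniq_sqr_dvd[q qv q2]; case/negP: nbad.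
  apply/existsP; exists (Ordinal (ltM q qv)) => /=.
  rewrite pv // yv //= (dvdn_trans q2 (dvdn_trans vs sm)) andbT.
  by apply: le_trans v3; rewrite ler_nat dvdn_leq.
(* The largest of the k primes: taking logarithms in X^(delta (k - 1)) x^(h - k + 1) <= 10 X^3. *)
have xw : x%:R <= X `^ gamma.
  have xv : x \in v by rewrite mem_rcons inE eqxx.
  have x0 : (0 < x)%N by rewrite prime_gt0 // pv.
  have yu : (X `^ delta) ^+ k.-1 <= (\prod_(p <- u) p)%N%:R.
    rewrite -su; have : {subset u <= v} by move=> p pu; rewrite mem_rcons inE pu orbT.
    elim: (u) => [|a t IH] subt; first by rewrite big_nil.
    rewrite big_cons exprS natrM; apply: ler_pM; rewrite ?exprn_ge0 ?(ltW y0) //.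
      by apply: yv; apply: subt; rewrite mem_head.
    by apply: IH => b bt; apply: subt; rewrite inE bt orbT.
  have le1 : (X `^ delta) ^+ k.-1 * x%:R ^+ (h - k.-1) <= 10 * X ^+ 3.
    apply: le_trans mX; apply: (@le_trans _ _ ((\prod_(p <- u) p * x ^ (h - k.-1))%N%:R)).
      by rewrite natrM natrX ler_wpM2r // exprn_ge0.
    by rewrite ler_nat.
  have xR : (0 : R) < x%:R by rewrite ltr0n.
  have : ln ((X `^ delta) ^+ k.-1 * x%:R ^+ (h - k.-1)) <= ln (10 * X ^+ 3).
    by rewrite ler_ln ?posrE ?mulr_gt0 ?exprn_gt0 ?ltr0n.
  rewrite (lnM (x := _ ^+ k.-1)) ?posrE ?exprn_gt0 // (lnM (x := 10)) ?posrE ?exprn_gt0 ?ltr0n //.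
  rewrite !ln_expn // ln_powR.
  have -> : (h - k.-1)%:R = h%:R - k%:R + 1 :> R.
    by rewrite natrB ?(leq_trans (leq_pred _)) // -[in RHS](prednK k_gt0) -natr1; ring.
  have -> : k.-1%:R = k%:R - 1 :> R by rewrite -[in RHS](prednK k_gt0) -natr1; ring.
  move=> le2; have hk0 : (0 : R) < h%:R - k%:R + 1.
    by rewrite ltr_wpDl // subr_ge0 ler_nat.
  rewrite -ler_ln ?posrE ?powR_gt0 // ln_powR -(ler_pM2l hk0).
  by lra.
have nv i : (i < k)%N -> nth 0%N v i \in v by move=> ik; rewrite mem_nth // szv.
pose P : {ffun 'I_k -> 'I_(Num.truncn (3 * X)).+1} :=
  [ffun i : 'I_k => Ordinal (ltM _ (nv i (ltn_ord i)))].
have PE i : P i = nth 0%N v i :> nat by rewrite ffunE.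
exists P; split.
- move=> i j /(congr1 val) /=; rewrite !PE => /eqP; rewrite nth_uniq ?szv //.
  by move=> /eqP e; exact: val_inj.
- apply/andP; split; first by apply/forallP => i; rewrite PE pv ?yv ?nv.
  under eq_bigr do rewrite PE.
  by rewrite -(big_mkord xpredT (fun i => nth 0%N v i)) -szv -(big_nth 0%N xpredT id).
- move=> i; rewrite PE; apply: le_trans xw; rewrite ler_nat.
  by have := nv i (ltn_ord i); rewrite mem_rcons inE => /orP[/eqP->|/ux].
- move=> i; rewrite PE; apply: dvdn_trans (dvdn_trans vs sm).
  by rewrite (big_rem (nth 0%N v i)) ?nv //= dvdn_mulr.
Qed.
End TCount.

(** * Error terms and passage to the limit *)

Section Asymptotics.
Context {R : realType}.

Lemma ln_le_powR (X a : R) : 0 < X -> a * ln X <= X `^ a.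
Proof.
move=> X0; rewrite /powR gt_eqF //; apply: le_trans (expR_ge1Dx _).
by rewrite lerDr.
Qed.

Lemma card_large_primes_powR (k M : nat) (X delta : R) : (0 < k)%N -> 0 < delta ->
  1 <= ln X -> ln 3 <= ln X -> 1 < X ->
  #|[pred P : {ffun 'I_k -> 'I_M} | large_primes (X `^ delta) (3 * X) P]|%:R <=
    (3 * ln 4 / delta) ^+ k * (X / ln X).
Proof.
case: k => // k _ d0 lX1 lX3 X1; have X0 : 0 < X by lra.
have lX0 : 0 < ln X by lra. have dl0 : 0 < delta * ln X by rewrite mulr_gt0.
have l4 : 0 <= ln 4 :> R by rewrite ln_ge0 // ler1n.
have y1 : 1 < X `^ delta by rewrite -[ltRHS]lnK ?posrE ?powR_gt0 // expR_gt1 ln_powR.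
have Z1 : 1 <= 3 * X by lra.
have := card_large_primes k M y1 Z1; rewrite ln_powR -ler_pdivlMr // => /le_trans; apply.
have hb : ln 4 * (1 + ln (3 * X)) / (delta * ln X) <= 3 * ln 4 / delta.
  rewrite ler_pdivrMr // mulrA divfK ?gt_eqF // -mulrA mulrCA ler_wpM2l //.
  by rewrite lnM ?posrE ?ltr0n //; lra.
have D0 : 0 <= 3 * ln 4 / delta by rewrite divr_ge0 ?mulr_ge0 // ltW.
have hk : (ln 4 * (1 + ln (3 * X)) / (delta * ln X)) ^+ k <= (3 * ln 4 / delta) ^+ k.
  rewrite lerXn2r ?nnegrE // divr_ge0 ?(ltW dl0) // mulr_ge0 // addr_ge0 //.
  by rewrite ln_ge0.
apply: (@le_trans _ _ (ln 4 * (3 * X) * (3 * ln 4 / delta) ^+ k / (delta * ln X))).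
  apply: ler_wpM2r; first by rewrite invr_ge0 ltW.
  by apply: ler_wpM2l => //; rewrite mulr_ge0 ?mulr_ge0 ?(ltW X0).
rewrite exprS le_eqVlt; apply/orP; left; apply/eqP.
by field; rewrite !gt_eqF.
Qed.

Lemma Tcount_le_prsum (delta gamma : R) (h : nat) (k := (h %/ 3)%N) :
  0 < delta -> (3 <= h)%N ->
  3 - (k%:R - 1) * delta < gamma * (h%:R - k%:R + 1) ->
  exists C X1 : R, 0 <= C /\ forall X, X1 <= X -> 1 < ln X /\
    (Tcount X delta h)%:R <=
      X * (k`!%:R^-1 * prsum (X `^ delta) (X `^ gamma) ^+ k + C / ln X).
Proof.
move=> d0 h3 hg; set g0 := gamma * (h%:R - k%:R + 1) - (3 - (k%:R - 1) * delta).
have g00 : 0 < g0 by rewrite subr_gt0.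
have l1 n : 0 <= ln n.+1%:R :> R by rewrite ln_ge0 // ler1n.
(* For ln X >= T: ln 4 / delta gives X^delta >= 4 for [card_sqr_bad], and ln 10 / g0 gives the
   hypothesis of [good_tuple]. *)
pose T := 2 + ln 3 + ln 4 / delta + ln 10 / g0.
pose D := 3 * ln 4 / delta.
have D0 : 0 <= D by rewrite /D divr_ge0 ?mulr_ge0 ?(l1 3) // ltW.
(* The first term of C pays for the rounding errors of the tuples, the others for the n in
   [sqr_bad]: X^delta >= delta ln X gives 6 / delta, and (3 X)^(1/2) >= (ln X) / 2 gives 18. *)
exists (3 ^+ k * D ^+ k + (6 / delta + 18)), (expR T); split.
  rewrite addr_ge0 ?mulr_ge0 ?exprn_ge0 // addr_ge0 // divr_ge0 // ltW //.
move=> X XT; have X0 : 0 < X by apply: lt_le_trans XT; exact: expR_gt0.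
have lX : T <= ln X by rewrite -[T]expRK ler_ln ?posrE ?expR_gt0.
have t4 : 0 <= ln 4 / delta by rewrite divr_ge0 ?(l1 3) // ltW.
have t10 : 0 <= ln 10 / g0 by rewrite divr_ge0 ?(l1 9) // ltW.
have l3 := l1 2.
have lX1 : 1 < ln X by move: lX; rewrite /T; lra.
have lX3 : ln 3 <= ln X by move: lX; rewrite /T; lra.
have lX4 : ln 4 / delta <= ln X by move: lX; rewrite /T; lra.
have lX10 : ln 10 / g0 <= ln X by move: lX; rewrite /T; lra.
have lX0 : 0 < ln X by lra.
have X1 : 1 < X by rewrite -[ltRHS]lnK ?posrE // expR_gt1.
split=> //.
have y4 : 4 <= X `^ delta.
  by rewrite -ler_ln ?posrE ?powR_gt0 ?ltr0n // ln_powR mulrC -ler_pdivrMr.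
have hX : ln 10 <= g0 * ln X by rewrite mulrC -ler_pdivrMr.
set S := many_large_primes delta h X.
pose Bd := [set n in dyadic X | sqr_bad delta X n].
have sS : (#|S| <= #|S :\: Bd| + #|Bd|)%N.
  rewrite -(cardsID Bd S) addnC leq_add2l; apply: subset_leq_card.
  exact: subsetIr.
have TS : (Tcount X delta h)%:R <= #|S :\: Bd|%:R + #|Bd|%:R :> R.
  by rewrite -natrD ler_nat (leq_trans (Tcount_le_card _ _ X0)).
have k0 : (0 < k)%N by rewrite divn_gt0.
have good : k`!%:R * #|S :\: Bd|%:R <= X * prsum (X `^ delta) (X `^ gamma) ^+ k
     + 3 ^+ k * (D ^+ k * (X / ln X)).
  apply: (@le_trans _ _ (X * prsum (X `^ delta) (X `^ gamma) ^+ k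
     + 3 ^+ k * #|[pred P : {ffun 'I_k -> 'I_(Num.truncn (3 * X)).+1} |
         large_primes (X `^ delta) (3 * X) P]|%:R)); last first.
    by rewrite lerD2l ler_wpM2l ?exprn_ge0 // card_large_primes_powR // ltW.
  apply: card_tuples_le; [exact: ltW|exact: powR_ge0| |].
    apply/fintype.subsetP => n; rewrite !inE => /andP[_].
    by move=> /andP[].
  move=> n; rewrite finset.in_setD => /andP[nb nS].
  apply: good_tuple => //.
  apply: contra nb => bad; rewrite finset.in_set bad andbT.
  by move: nS; rewrite finset.in_set => /andP[].
have bad : #|Bd|%:R <= (6 / delta + 18) * (X / ln X).
  apply: (le_trans (card_sqr_bad X0 y4)); rewrite [leRHS]mulrDl; apply: lerD.
    rewrite (_ : 6 / delta * (X / ln X) = 6 * X / (delta * ln X)); last first.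
      by field; rewrite !gt_eqF.
    apply: ler_wpM2l; first by rewrite mulr_ge0 // ltW.
    by rewrite lef_pV2 ?posrE ?powR_gt0 ?mulr_gt0 // ln_le_powR.
  have X30 : 0 < 3 * X by rewrite mulr_gt0.
  have s0 : 0 < (3 * X) `^ 2^-1 by rewrite powR_gt0.
  have s2 : (3 * X) `^ 2^-1 * (3 * X) `^ 2^-1 = 3 * X.
    rewrite -powRD; last by rewrite gt_eqF ?implybT.
    by rewrite (_ : 2^-1 + 2^-1 = 1 :> R) ?powRr1 ?(ltW X30) //; field.
  have sl : ln X / 2 <= (3 * X) `^ 2^-1.
    apply: le_trans (ln_le_powR _ X30); rewrite mulrC ler_wpM2l ?invr_ge0 //.
    by rewrite lnM ?posrE ?ltr0n // lerDr.
  rewrite mulrA ler_pdivlMr //; move: s2 sl; set s := _ `^ _ => s2 sl.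
  have : s * (ln X / 2) <= s * s by rewrite ler_wpM2l // ltW.
  by rewrite s2; lra.
have kf : (1 : R) <= k`!%:R by rewrite ler1n fact_gt0.
have kf0 : (0 : R) < k`!%:R by lra.
apply: (le_trans TS).
have XlX : 0 <= X / ln X by rewrite divr_ge0 // ltW.
have W0 : 0 <= 3 ^+ k * (D ^+ k * (X / ln X)).
  by apply: mulr_ge0 (exprn_ge0 _ (ler0n _ _)) (mulr_ge0 (exprn_ge0 _ D0) XlX).
have : #|S :\: Bd|%:R <= k`!%:R^-1 * (X * prsum (X `^ delta) (X `^ gamma) ^+ k)
     + 3 ^+ k * (D ^+ k * (X / ln X)).
  rewrite -(ler_pM2l kf0); apply: (le_trans good).
  rewrite mulrDr mulVKf ?gt_eqF // lerD2l ler_peMl //.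
move/(lerD)/(_ bad)/le_trans; apply.
rewrite le_eqVlt; apply/orP; left; apply/eqP.
by field; rewrite !gt_eqF.
Qed.

Lemma exprD_le (l t : R) (k : nat) : 0 <= l -> 0 <= t -> t <= 1 ->
  (l + t) ^+ k <= l ^+ k + t * (k%:R * (l + 1) ^+ k).
Proof.
move=> l0 t0 t1; elim: k => [|k IH]; first by rewrite !expr0 mul0r mulr0 addr0.
have p0 : 0 <= l ^+ k by rewrite exprn_ge0.
have q0 : 0 <= (l + 1) ^+ k by rewrite exprn_ge0 // addr_ge0.
have pq : l ^+ k <= (l + 1) ^+ k by rewrite lerXn2r ?nnegrE ?addr_ge0 // lerDl.
rewrite !exprS; apply: (@le_trans _ _ ((l + t) * (l ^+ k + t * (k%:R * (l + 1) ^+ k)))).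
  by rewrite ler_wpM2l // addr_ge0.
move: IH p0 q0 pq; move: (l ^+ k) ((l + 1) ^+ k) => p q _ p0 q0 pq.
have kq : 0 <= k%:R * q by rewrite mulr_ge0.
have h1 : t * (k%:R * q) * (l + t) <= t * (k%:R * q) * (l + 1).
  by apply: ler_wpM2l; [rewrite mulr_ge0|rewrite lerD2l].
have h2 : t * p <= t * ((l + 1) * q).
  apply: ler_wpM2l => //; apply: (le_trans pq); rewrite ler_peMl // lerDr.
  by [].
rewrite -natr1; lra.
Qed.

End Asymptotics.

Lemma Tcount_asymp (R : realType) (delta : R) (h : nat) (k := (h %/ 3)%N)
    (main := k`!%:R^-1 *
       ln ((3 - (k%:R - 1) * delta) / ((h%:R - k%:R + 1) * delta)) ^+ k) (e : R) :
  0 < delta -> (3 <= h)%N -> (odd k -> h%:R * delta <= 3) -> 0 < e ->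
  exists X0 : R, forall X, X0 <= X ->
    0 < X /\ (Tcount X delta h)%:R <= X * (main + e).
Proof.
move=> d0 h3 odd_k e0.
have kf0 : (0 : R) < k`!%:R by rewrite ltr0n fact_gt0.
(* If h delta > 3, the count vanishes for large X, and k is even by [odd_k], so the main term is
   nonnegative whatever value [ln] takes. Otherwise h delta <= 3, which is equivalent to delta <=
   beta, so the logarithm is nonnegative. *)
have [hd|hd] := leP (h%:R * delta) 3; last first.
  have m0 : 0 <= main.
    rewrite /main mulr_ge0 ?invr_ge0 ?(ltW kf0) // exprn_even_ge0 //.
    by apply/negP => /odd_k; rewrite leNgt hd.
  have g0 : 0 < h%:R * delta - 3 by rewrite subr_gt0.
  exists (expR (1 + ln 10 / (h%:R * delta - 3))) => X hX.
  have X0 : 0 < X by apply: lt_le_trans hX; exact: expR_gt0.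
  have t0 : 0 <= ln 10 / (h%:R * delta - 3) by rewrite divr_ge0 ?(ltW g0) // ln_ge0 // ler1n.
  have lX : 1 + ln 10 / (h%:R * delta - 3) <= ln X.
    by rewrite -[leLHS]expRK ler_ln ?posrE ?expR_gt0.
  have X1 : 1 <= X by apply: le_trans hX; apply: le_trans (expR_ge1Dx _); lra.
  split=> //; have := Tcount_le_card delta h X0.
  rewrite many_large_primes_eq0 // ?leqn0 => [/eqP -> |].
    by rewrite mulr_ge0 ?(ltW X0) // addr_ge0 // ltW.
  rewrite mulrC -ltr_pdivrMr //; lra.
have hk0 : (0 : R) < h%:R - k%:R + 1.
  by rewrite ltr_wpDl // subr_ge0 ler_nat leq_div.
pose beta := (3 - (k%:R - 1) * delta) / (h%:R - k%:R + 1).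
have bd : delta <= beta by rewrite /beta ler_pdivlMr //; lra.
have b0 : 0 < beta by exact: lt_le_trans bd.
pose l := ln (beta / delta).
have mainE : main = k`!%:R^-1 * l ^+ k by rewrite /main /l /beta invfM mulrA.
have l0 : 0 <= l by rewrite /l ln_ge0 // ler_pdivlMr // mul1r.
pose K := k%:R * (l + 1) ^+ k.
have K0 : 0 <= K by rewrite /K mulr_ge0 // exprn_ge0 // addr_ge0.
(* t is the total excess allowed over l, half for gamma > beta and half for the error of
   [prsum_asymp]; by [exprD_le] it changes the k-th power by at most t K <= e / 2. *)
pose t := Num.min 1 (e / (2 * (K + 1))).
have K10 : 0 < 2 * (K + 1) by rewrite mulr_gt0 // ltr_wpDl.
have t0 : 0 < t by rewrite lt_min ltr01 divr_gt0.
have t1 : t <= 1 by rewrite ge_min lexx.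
have tK : t * K <= e / 2.
  have : t <= e / (2 * (K + 1)) by rewrite ge_min lexx orbT.
  by rewrite ler_pdivlMr //; nra.
have t20 : 0 < t / 2 by rewrite divr_gt0.
pose gamma := beta * (1 + t / 2).
have bg : beta < gamma by rewrite /gamma ltr_pMr // ltrDl.
have hg : 3 - (k%:R - 1) * delta < gamma * (h%:R - k%:R + 1).
  by rewrite -ltr_pdivrMr.
have [C [X1 [C0 hC]]] := Tcount_le_prsum d0 h3 hg.
have [X2 hX2] := prsum_asymp d0 (le_trans bd (ltW bg)) t20.
have lg : ln (gamma / delta) + t / 2 <= l + t.
  have bd0 := divr_gt0 b0 d0; have t21 := addr_gt0 ltr01 t20.
  rewrite /gamma mulrAC lnM ?posrE // -/l.
  by have := ln_le_sub1 t21; lra.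
exists (Num.max (Num.max X1 X2) (expR (2 * C / e))) => X; rewrite !ge_max => /andP[/andP[h1 h2] h3'].
have X0 : 0 < X by apply: lt_le_trans h3'; exact: expR_gt0.
split=> //; have [lX1 hT] := hC X h1.
apply: (le_trans hT); apply: (ler_wpM2l (ltW X0)).
have lX : 2 * C / e <= ln X by rewrite -[leLHS]expRK ler_ln ?posrE ?expR_gt0.
have Ce : C / ln X <= e / 2.
  rewrite ler_pdivrMr ?(lt_trans ltr01) //; move: lX; rewrite ler_pdivrMr //; lra.
have P0 := prsum_ge0 (X `^ delta) (X `^ gamma).
have Ple : prsum (X `^ delta) (X `^ gamma) <= l + t by exact: le_trans (hX2 X h2) lg.
have Pk : prsum (X `^ delta) (X `^ gamma) ^+ k <= l ^+ k + t * K.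
  apply: le_trans (exprD_le k l0 (ltW t0) t1).
  by rewrite lerXn2r ?nnegrE // (le_trans P0).
have : k`!%:R^-1 * prsum (X `^ delta) (X `^ gamma) ^+ k <= main + e / 2.
  rewrite mainE; apply: (@le_trans _ _ (k`!%:R^-1 * (l ^+ k + e / 2))).
    by apply: ler_wpM2l; rewrite ?invr_ge0 ?(ltW kf0) //; lra.
  rewrite mulrDr lerD2l ler_piMl ?divr_ge0 ?(ltW e0) //.
  by rewrite invf_le1 // ler1n fact_gt0.
lra.
Qed.

Unset Implicit Arguments.
Local Open Scope classical_set_scope.

(* For k odd and h delta > 3 the main term is negative (or the logarithm is
   undefined) whereas T(h, delta) >= 0, so the estimate is false; the last
   hypothesis excludes exactly these parameters. *)
Theorem lemma3p2 (R : realType) (delta : R) (h k : nat)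
  (delta_gt0 : 0 < delta) (delta_lt1 : delta < 1)
  (h_ge3 : (3 <= h)%N) (kE : k = (h %/ 3)%N)
  (main_term_ge0 : odd k -> h%:R * delta <= 3) :
  exists eps : R -> R,
    eps X @[X --> +oo] --> (0 : R) /\
    forall X : R, 0 < X ->
      (Tcount X delta h)%:R <=
        X * ((k`!)%:R^-1 *
               ln ((3 - (k%:R - 1) * delta) / ((h%:R - k%:R + 1) * delta)) ^+ k
             + eps X).
Proof.
subst k; pose main : R := (((h %/ 3)%N`!)%:R^-1 *
  ln ((3 - ((h %/ 3)%N%:R - 1) * delta) / ((h%:R - (h %/ 3)%N%:R + 1) * delta)) ^+ (h %/ 3)%N).
(* The least nonnegative error that makes the inequality true; [Tcount_asymp], for each e, says that
   it is eventually at most e. *)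
exists (fun X => Num.max 0 ((Tcount X delta h)%:R / X - main)); split.
  apply/cvgrPdist_le => e e0.
  have [X0 hX0] := Tcount_asymp delta_gt0 h_ge3 main_term_ge0 e0.
  exists X0; split; first exact: num_real.
  move=> X /ltW /hX0[Xgt0 hT]; rewrite sub0r normrN ger0_norm ?le_max ?lexx //.
  rewrite ge_max (ltW e0) /= lerBlDl ler_pdivrMr // mulrC; exact: hT.
move=> X X0; rewrite -/main mulrC -ler_pdivrMr // -lerBlDl le_max lexx orbT //.
Qed.
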